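(* Let $N,n\in\mathbb N$ with $n$ even and dividing $N$, and let $\epsilon>0$. Let $\Psi_1$ contain only the two uniform $n$-block strings in $\{0,1\}^N$, and let $\Psi_2$ be the set of $n$-block strings $x\in\{0,1\}^N$ with $d_{\mathrm{rel\text{-}edit}}(x,y)>\epsilon$ for both $y\in\Psi_1$. There is a $(\Psi_1,\Psi_2,\rho,2/3)$-trace tester using one trace of expected size $\rho N=\widetilde O\left(\left(\frac n\epsilon\right)^{4/5}+\frac{\sqrt n}{\epsilon^2}\right)$, where $\widetilde O$ hides polylogarithmic factors in $n$.
   Context: A block is a maximal run of equal symbols; $x$ is an $n$-block string if it has at most $n$ blocks. The uniform $n$-block strings are $1^{N/n}0^{N/n}1^{N/n}\cdots$ and $0^{N/n}1^{N/n}0^{N/n}\cdots$ ($n$ blocks each). A trace of $x\in\{0,1\}^N$ with retention rate $\rho$ is obtained by deleting each character independently with probability $1-\rho$; its expected size is $\rho N$. A $(\Psi_1,\Psi_2,\rho,\alpha)$-trace tester using $k$ traces receives $k$ independent traces of the unknown $x$, accepts with probability $\ge\alpha$ if $x\in\Psi_1$ and rejects with probability $\ge\alpha$ if $x\in\Psi_2$. $d_{\mathrm{rel\text{-}edit}}(x,y)=\frac{2}{N+M}\mathrm{ed}(x,y)$ for $x\in\{0,1\}^N,y\in\{0,1\}^M$, $\mathrm{ed}$ the standard edit distance. *)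

(* Defs.v *)
From mathcomp Require Import all_boot all_order all_algebra.
From mathcomp Require Import boolp reals exp.

Set Implicit Arguments.
Unset Strict Implicit.
Unset Printing Implicit Defensive.

Import Order.TTheory GRing.Theory Num.Theory.
Local Open Scope ring_scope.

(* The blocks (maximal runs of equal symbols) of s, from left to right; every
   block in the list is nonempty, so the last case is only reached when
   s' is empty. *)
Fixpoint blocks (s : seq bool) : seq (seq bool) :=
  if s is a :: s' then
    if blocks s' is (b :: r) :: bs then
      if a == b then (a :: b :: r) :: bs else [:: a] :: (b :: r) :: bs
    else [:: [:: a]]
  else [::].

Definition block_string (n : nat) (s : seq bool) : bool :=
  (size (blocks s) <= n)%N.

(* The n blocks have length N / n and alternate, starting with the symbol a. *)
Definition uniform_block_string (N n : nat) (a : bool) : seq bool :=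
  flatten [seq nseq (N %/ n) (a (+) odd i) | i <- iota 0 n].

Inductive edit_step : seq bool -> seq bool -> Prop :=
| edit_insert s t a : edit_step (s ++ t) (s ++ a :: t)
| edit_delete s t a : edit_step (s ++ a :: t) (s ++ t)
| edit_subst s t a b : edit_step (s ++ a :: t) (s ++ b :: t).

Inductive edits : nat -> seq bool -> seq bool -> Prop :=
| edits0 s : edits 0 s s
| editsS k s t u : edit_step s t -> edits k t u -> edits k.+1 s u.

Lemma edits_exists (s t : seq bool) : exists k, `[< edits k s t >].
Proof.
suff [k Hk] : exists k, edits k s t by exists k; apply/asboolP.
elim: s => [|a s [k Hk]].
  suff H u v : edits (size v) u (u ++ v) by exists (size t); exact: (H [::] t).
  elim: v u => [|a v IH] u /=; first by rewrite cats0; exact: edits0.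
  apply: (editsS (t := rcons u a)).
    by rewrite -[X in edit_step X]cats0 -cats1; exact: edit_insert.
  by rewrite -cat_rcons; exact: IH.
by exists k.+1; apply: editsS Hk; exact: (edit_delete [::]).
Qed.

(* Levenshtein distance: the least number of single-symbol insertions,
   deletions and substitutions turning s into t. *)
Definition ed (s t : seq bool) : nat := ex_minn (edits_exists s t).

Definition rel_edit (R : realType) (s t : seq bool) : R :=
  2 / (size s + size t)%:R * (ed s t)%:R.

(* Probability of the retention pattern m, where m_i = true means that the
   i-th symbol is kept; the corresponding trace of x is mask m x. *)
Definition retention_pr (R : realType) (N : nat) (rho : R)
    (m : N.-tuple bool) : R :=
  \prod_(i < N) (if tnth m i then rho else 1 - rho).

(* Probability that k independent traces of x, of retention rate rho, satisfy
   the event E. *)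
Definition traces_pr (R : realType) (N k : nat) (rho : R) (x : N.-tuple bool)
    (E : pred (k.-tuple (seq bool))) : R :=
  \sum_(m : {ffun 'I_k -> N.-tuple bool} | E [tuple mask (m i) x | i < k])
    \prod_(i < k) retention_pr rho (m i).

Definition trace_tester (R : realType) (N k : nat)
    (Psi1 Psi2 : {set N.-tuple bool}) (rho alpha : R)
    (accept : k.-tuple (seq bool) -> bool) : Prop :=
  (forall x, x \in Psi1 -> alpha <= traces_pr rho x accept) /\
  (forall x, x \in Psi2 -> alpha <= traces_pr rho x (fun w => ~~ accept w)).

Definition uniform_strings (N n : nat) : {set N.-tuple bool} :=
  [set x : N.-tuple bool |
     (tval x == uniform_block_string N n true)
  || (tval x == uniform_block_string N n false)].

Definition far_block_strings (R : realType) (N n : nat) (eps : R) :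
    {set N.-tuple bool} :=
  [set x : N.-tuple bool | block_string n x &
     [forall y in uniform_strings N n, eps < rel_edit R x y]].

(* Main.v *)
(* Pad the block lengths of [x] to a list [l_1, .., l_n]. If [x] is far from the
   uniform strings then [\sum_i |l_i - N / n| > eps N], since the edit distance
   is at most this sum. With [q] the deletion probability there are two regimes.

   If [M = 64 (n / eps) ^ (4 / 5)] is at most [n / 2], take [q = exp (- M / N)]
   and count the runs of the trace. Let [y_i] be the expected sign of the
   nearest retained symbol, relative to the symbol of block [i]; then
   [y_i = 1 - q ^ l_i (1 + y_(i-1))], and twice the expected number of runs is
   [\sum_i (y_(i-1) + y_i)] up to an additive constant. As
   [l_i M / N = ln (1 + y_(i-1)) - ln (1 - y_i)], the sum of the [artanh y_i] is
   essentially prescribed, and concavity of [tanh] makes the uniform strings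
   maximize the expected number of runs, a far string losing order
   [eps ^ 2 M ^ 3 / n ^ 2]. By the Efron-Stein inequality the variance is
   [O(M)] for every string, so Chebyshev's inequality suffices.

   Otherwise [sqrt n eps ^ 2 = O(1)], and a trace of expected size of order
   [ln n sqrt n / eps ^ 2] hits every block of a uniform string with high
   probability. The trace then has exactly [n] runs, whose lengths are
   independent binomial variables, and a chi-square statistic of these lengths
   is thresholded. *)
Require Import Defs.
From mathcomp Require Import all_boot all_order all_algebra.
From mathcomp Require Import boolp reals topology normedtype sequences derive exp.
From mathcomp Require Import ring lra.

Set Implicit Arguments.
Unset Strict Implicit.
Unset Printing Implicit Defensive.

Import Order.TTheory GRing.Theory Num.Theory.
Import numFieldNormedType.Exports.

(** * Strings with few blocks *)

(* Alternating blocks of lengths [ls], starting with [a]; empty blocks are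
   allowed, so that every string with at most [n] blocks is obtained from some
   [ls] of size exactly [n]. *)
Fixpoint alternating (a : bool) (ls : seq nat) : seq bool :=
  if ls is l :: ls' then nseq l a ++ alternating (~~ a) ls' else [::].

Lemma size_alternating a ls : size (alternating a ls) = sumn ls.
Proof. by elim: ls a => //= l ls IH a; rewrite size_cat size_nseq IH. Qed.

Lemma alternating_pad a ls j : alternating a (ls ++ nseq j 0) = alternating a ls.
Proof.
elim: ls a => [|l ls IH] a /=; last by rewrite IH.
by elim: j a => //= j IH a; rewrite IH.
Qed.

Lemma uniform_block_stringE N n a :
  uniform_block_string N n a = alternating a (nseq n (N %/ n)).
Proof.
rewrite /uniform_block_string; move: (N %/ n)%N => L.
rewrite -[in RHS](addbF a) -[false]/(odd 0).
elim: n 0%N => //= n IH m.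
by rewrite IH /= addbN.
Qed.

(** The first symbol is recorded because it decides whether a symbol put in front joins the first
    block. *)
Lemma blocks_spec s :
  match blocks s with
  | [::] => s = [::]
  | [::] :: _ => False
  | (b :: r) :: bs => ohead s = Some b /\ s = alternating b ((size r).+1 :: map size bs)
  end.
Proof.
elim: s => //= a s; case: (blocks s) => [->|[//|b r] bs [hs es]] //=.
case: (eqVneq a b) => [->|nab] /=; split=> //; rewrite [in LHS]es //=.
by have -> : ~~ a = b by move: nab; case: (a); case: (b).
Qed.

Lemma blocks_alternating s : exists a, s = alternating a (map size (blocks s)).
Proof.
have := blocks_spec s; case: (blocks s) => [->|[//|b r] bs [_ es]]; first by exists true.
by exists b.
Qed.

Lemma block_string_alternating n s : block_string n s ->
  exists a ls, size ls = n /\ s = alternating a ls.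
Proof.
move=> sn; have [a es] := blocks_alternating s.
exists a, (map size (blocks s) ++ nseq (n - size (blocks s)) 0); split.
  by rewrite size_cat size_map size_nseq subnKC.
by rewrite alternating_pad.
Qed.

Lemma blocks_nseq_cat k a s : ohead s != Some a ->
  blocks (nseq k.+1 a ++ s) = nseq k.+1 a :: blocks s.
Proof.
move=> hs; elim: k => [|k IH] /=.
  have := blocks_spec s; case: (blocks s) => [//|[//|b r] bs [e _]].
  by case: (eqVneq a b) hs => // ->; rewrite e eqxx.
by move: IH => /= ->; rewrite eqxx.
Qed.

Lemma map_size_blocks a ls : all (leq 1) ls -> map size (blocks (alternating a ls)) = ls.
Proof.
elim: ls a => [|[//|l] ls IH] a // pls.
rewrite [alternating _ _]/= -cat_cons (@blocks_nseq_cat l a (alternating (~~ a) ls)) /=.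
  by rewrite IH// size_nseq.
by case: ls pls {IH} => //= -[//|l'] ls _ /=; case: a.
Qed.

Lemma size_blocks_dup (a : bool) s : size (blocks (a :: a :: s)) = size (blocks (a :: s)).
Proof.
have -> : blocks (a :: a :: s) = if blocks (a :: s) is (b :: r) :: bs then
    if a == b then (a :: b :: r) :: bs else [:: a] :: (b :: r) :: bs else [:: [:: a]] by [].
by have := blocks_spec (a :: s); case: (blocks _) => [//|[//|b r] bs [[->] _]]; rewrite eqxx.
Qed.

Lemma size_blocks_alternating a ls :
  (size (blocks (alternating a ls)) <= count (leq 1) ls)%N.
Proof.
have h1 b s : (size (blocks (b :: s)) <= (size (blocks s)).+1)%N.
  by rewrite /=; case: (blocks s) => [|[|c r] bs] //=; case: (_ == _).
elim: ls a => //= -[|l] ls IH a /=; first exact: IH.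
elim: l => [|l IHl] /=; first by apply: leq_trans (h1 _ _) _; rewrite ltnS IH.
by apply: leq_trans IHl; rewrite size_blocks_dup.
Qed.

(** Used on far strings: a trace with the maximal number of runs has lost no block, so its run
    lengths are exactly the retained counts. *)
Lemma full_blocks a ls : size (blocks (alternating a ls)) = size ls ->
  map size (blocks (alternating a ls)) = ls.
Proof.
move=> e; apply: map_size_blocks; rewrite all_count eqn_leq count_size.
by rewrite -{1}e size_blocks_alternating.
Qed.

(** * Edit distance to a uniform string, block by block *)

Lemma edits_trans k l s t u : edits k s t -> edits l t u -> edits (k + l) s u.
Proof. by elim=> // k' s' t' u' h _ IH /IH; rewrite addSn; exact: editsS. Qed.

Lemma edits_catl k s t u : edits k s t -> edits k (u ++ s) (u ++ t).
Proof.
elim=> [s'|k' s' t' u' h _ IH]; first exact: edits0.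
apply: editsS IH; case: h => [x y a|x y a|x y a b]; rewrite !catA;
  [exact: edit_insert|exact: edit_delete|exact: edit_subst].
Qed.

(** With truncated subtraction, [l - m + (m - l)] is the absolute difference. *)
Lemma edits_nseq (a : bool) l m s : edits (l - m + (m - l)) (nseq l a ++ s) (nseq m a ++ s).
Proof.
elim: l m => [|l IH] [|m].
- exact: edits0.
- rewrite sub0n subn0 add0n; elim: m => [|m IH].
    by apply: (editsS (edit_insert [::] s a)); exact: edits0.
  apply: editsS (edits_catl [:: a] IH).
  exact: (edit_insert [::] s a).
- rewrite sub0n subn0 addn0; elim: {IH} l => [|l IH].
    by apply: (editsS (edit_delete [::] s a)); exact: edits0.
  apply: editsS IH; exact: (edit_delete [::] (nseq l.+1 a ++ s) a).
- by rewrite !subSS; exact: (edits_catl [:: a] (IH m)).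
Qed.

Lemma edits_alternating a L ls :
  edits (\sum_(l <- ls) (l - L + (L - l)))
    (alternating a ls) (alternating a (nseq (size ls) L)).
Proof.
elim: ls a => [|l ls IH] a /=; first by rewrite big_nil; exact: edits0.
rewrite big_cons.
exact: edits_trans (edits_nseq a l L _) (edits_catl (nseq L a) (IH (~~ a))).
Qed.

Lemma ed_le k s t : edits k s t -> (ed s t <= k)%N.
Proof. by move=> h; rewrite /ed; case: ex_minnP => m _; apply; apply/asboolP. Qed.

Local Open Scope ring_scope.

(** * Inequalities for the inverse hyperbolic tangent *)

Lemma nneg_of_derive_ge0 (R : realType) (f f' : R -> R) (z : R) :
  (forall x : R, is_derive x 1 f (f' x)) -> (forall x, 0 <= x -> 0 <= f' x) ->
  f 0 = 0 -> 0 <= z -> 0 <= f z.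
Proof.
move=> df f'0 f0 z0; rewrite -f0.
apply: (@ger0_derive1_ndecry _ f 0) => // [x|].
- rewrite in_itv/= andbT => x0.
  by rewrite derive1E (@derive_val _ _ _ _ _ _ _ (df x)) f'0 ?ltW.
- apply: continuous_subspaceT => x.
  by apply/differentiable_continuous/derivable1_diffP; have [] := df x.
Qed.

(** This is [tanh (z / 2) <= z / 2] with denominators cleared. *)
Lemma expR_pade (R : realType) (z : R) : 0 <= z -> 2 * (expR z - 1) <= z * (expR z + 1).
Proof.
move=> z0; rewrite -subr_ge0.
apply: (@nneg_of_derive_ge0 _ (fun z => z * (expR z + 1) - 2 * (expR z - 1))
  (fun z => (z - 1) * expR z + 1)) z0 => [x|x x0|]; last by rewrite expR0; ring.
- apply: is_derive_eq.
  rewrite /= /GRing.scale/=; ring.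
- have := expR_ge1Dx (- x); rewrite expRN => h.
  have e0 := expR_gt0 x.
  have := ler_wpM2r (ltW e0) h; rewrite mulVf ?gt_eqF//; lra.
Qed.

Lemma sinh_ge (R : realType) (z : R) : 0 <= z -> 2 * z <= expR z - expR (- z).
Proof.
move=> z0; rewrite -subr_ge0.
apply: (@nneg_of_derive_ge0 _ (fun z => expR z - expR (- z) - 2 * z)
  (fun z => expR z + expR (- z) - 2)) z0 => [x|x x0|]; last by rewrite oppr0 expR0; ring.
- apply: is_derive_eq.
  rewrite /= /GRing.scale/=; ring.
- have := expR_ge1Dx (- x); have := expR_ge1Dx x; lra.
Qed.
(** The logarithmic mean is at most the arithmetic mean: [expR_pade] at [ln x - ln y]. *)
Lemma ln_sub_ge (R : realType) (x y : R) : 0 < y -> y <= x ->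
  2 * (x - y) / (x + y) <= ln x - ln y.
Proof.
move=> y0 yx; have x0 : 0 < x by lra.
have h : 0 <= ln x - ln y by rewrite subr_ge0 ler_ln.
have := expR_pade h; rewrite expRB !lnK// => k.
rewrite ler_pdivrMr ?addr_gt0//.
have := ler_wpM2r (ltW y0) k.
have -> : 2 * (x / y - 1) * y = 2 * (x - y) by field; lra.
have -> // : (ln x - ln y) * (x / y + 1) * y = (ln x - ln y) * (x + y) by field; lra.
Qed.

(** The logarithmic mean is at least the geometric mean, squared to avoid the root: [sinh_ge] at
    half of [ln x - ln y]. *)
Lemma ln_sub_sqr_le (R : realType) (x y : R) : 0 < y -> y <= x ->
  (ln x - ln y) ^+ 2 * (x * y) <= (x - y) ^+ 2.
Proof.
move=> y0 yx; have x0 : 0 < x by lra.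
set z := ln x - ln y.
have z0 : 0 <= z by rewrite subr_ge0 ler_ln.
have h : 0 <= z / 2 by lra.
have := sinh_ge h; rewrite expRN.
have : expR (z / 2) ^+ 2 = x / y.
  rewrite -expRM_natr mulfVK ?expRB ?lnK// pnatr_eq0//.
have := expR_gt0 (z / 2); set e := expR _ => e0 e2 k.
have {}k : z * e <= e ^+ 2 - 1.
  have := ler_wpM2r (ltW e0) k; rewrite [(e - _) * e]mulrBl mulVf ?gt_eqF//; lra.
have k2 : (z * e) ^+ 2 <= (e ^+ 2 - 1) ^+ 2.
  have ze : 0 <= z * e by rewrite mulr_ge0// ltW.
  by rewrite lerXn2r// nnegrE (le_trans ze).
move: k2; rewrite exprMn e2 => k2.
have := ler_wpM2r (exprn_ge0 2 (ltW y0)) k2.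
have -> : z ^+ 2 * (x / y) * y ^+ 2 = z ^+ 2 * (x * y) by field; lra.
have -> // : (x / y - 1) ^+ 2 * y ^+ 2 = (x - y) ^+ 2 by field; lra.
Qed.

Definition artanh (R : realType) (y : R) : R := (ln (1 + y) - ln (1 - y)) / 2.

(** Since [artanh] is convex on [[0, 1)] with slope [1 / (1 - t ^ 2)] at [t], this is its tangent
    bound with a quadratic remainder. Right of [t] the arithmetic mean bound suffices; left of [t]
    the geometric mean bound is used. *)
Lemma artanh_tangent (R : realType) (x t : R) : 0 <= x < 1 -> 0 < t < 1 ->
  x - t + t / 2 * (t - x) ^+ 2 <= (1 - t ^+ 2) * (artanh x - artanh t).
Proof.
move=> /andP[x0 x1] /andP[t0 t1].
have [p1 p2 p3 p4] : [/\ 0 < 1 + x, 0 < 1 - x, 0 < 1 + t & 0 < 1 - t] by split; lra.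
have E : artanh x - artanh t = (ln ((1 + x) * (1 - t)) - ln ((1 - x) * (1 + t))) / 2.
  by rewrite !lnM// /artanh; lra.
have tt : 0 < 1 - t ^+ 2 by nra.
have [tx|xt] := leP t x.
  have h := @ln_sub_ge _ ((1 + x) * (1 - t)) ((1 - x) * (1 + t)) (mulr_gt0 p2 p3) ltac:(nra).
  have q : 0 < 1 - x * t by nra.
  have {}h : (x - t) / (1 - x * t) <= artanh x - artanh t.
    rewrite E; move: h; set b := _ - ln _; set c := _ / _ => h.
    have -> : (x - t) / (1 - x * t) = c / 2 by rewrite /c; field; lra.
    lra.
  apply: le_trans (ler_wpM2l (ltW tt) h).
  rewrite [leRHS]mulrA ler_pdivlMr//.
  have -> : (1 - t ^+ 2) * (x - t) = (x - t) * (1 - x * t) + t * (x - t) ^+ 2 by ring.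
  have : t / 2 * (t - x) ^+ 2 * (1 - x * t) <= t / 2 * (t - x) ^+ 2 * 1.
    have xt0 : 0 <= x * t by rewrite mulr_ge0// ltW.
    apply: ler_wpM2l; last lra; apply: mulr_ge0; [lra|exact: sqr_ge0].
  have : 0 <= t * (t - x) ^+ 2 by rewrite mulr_ge0 ?sqr_ge0//; lra.
  nra.
have h := @ln_sub_sqr_le _ ((1 - x) * (1 + t)) ((1 + x) * (1 - t)) (mulr_gt0 p1 p4) ltac:(nra).
set D := artanh x - artanh t in E *.
have {E} E : ln ((1 - x) * (1 + t)) - ln ((1 + x) * (1 - t)) = - D * 2 by rewrite E; field.
rewrite E in h.
have {}h : D ^+ 2 * ((1 - x ^+ 2) * (1 - t ^+ 2)) <= (t - x) ^+ 2 by nra.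
(* [B] is the left-hand side negated. As [h] controls only [D ^+ 2], squares are compared, after
   multiplication by [1 - x ^+ 2]. *)
set B := (t - x) * (1 - t / 2 * (t - x)).
suff : (1 - t ^+ 2) * - D <= B by rewrite /B; lra.
have B0 : 0 <= B by rewrite mulr_ge0//; nra.
have xx : 0 < 1 - x ^+ 2 by nra.
suff H : ((1 - t ^+ 2) * - D) ^+ 2 <= B ^+ 2.
  have [D0|D0] := leP 0 ((1 - t ^+ 2) * - D); last lra.
  by rewrite -(@ler_pXn2r _ 2).
rewrite -(ler_pM2r xx).
apply: (@le_trans _ _ ((1 - t ^+ 2) * (t - x) ^+ 2)).
  have := ler_wpM2l (ltW tt) h; lra.
rewrite /B exprMn -[leRHS]mulrA [leLHS]mulrC; apply: ler_wpM2l; first exact: sqr_ge0.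
have q : 0 <= x * (t - x) * (1 + x * t).
  by apply: mulr_ge0; [apply: mulr_ge0; lra|have := mulr_ge0 x0 (ltW t0); lra].
have : (1 - x ^+ 2) * (1 - t * (t - x)) <= (1 - x ^+ 2) * (1 - t / 2 * (t - x)) ^+ 2.
  rewrite ler_pM2l//; have := sqr_ge0 (t / 2 * (t - x)); lra.
lra.
Qed.

(** The right-hand side is half of [ln p - ln q] with [p - q = 4 x d ^ 2] and [p + q <= 2], so
    [ln_sub_ge] applies. One of [u], [v] may be negative, as happens for biases next to an empty
    block. *)
Lemma artanh_midpoint (R : realType) (u v : R) : -1 < u < 1 -> -1 < v < 1 ->
  0 <= u + v ->
  2 * ((u + v) / 2) * ((u - v) / 2) ^+ 2 <= artanh u + artanh v - 2 * artanh ((u + v) / 2).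
Proof.
move=> /andP[u0 u1] /andP[v0 v1] uv.
set x := (u + v) / 2; set d := (u - v) / 2.
have -> : u = x + d by rewrite /x /d; field.
have -> : v = x - d by rewrite /x /d; field.
have [? ? ? ?] : [/\ 0 < 1 + (x + d), 0 < 1 - (x + d), 0 < 1 + (x - d) & 0 < 1 - (x - d)].
  by split; rewrite /x /d; lra.
have [? ? x0] : [/\ 0 < 1 + x, 0 < 1 - x & 0 <= x] by split; rewrite /x; lra.
pose p := (1 + (x + d)) * (1 + (x - d)) * ((1 - x) * (1 - x)).
pose q := (1 - (x + d)) * (1 - (x - d)) * ((1 + x) * (1 + x)).
have q0 : 0 < q by rewrite /q !mulr_gt0.
have pq : p - q = 4 * x * d ^+ 2 by rewrite /p /q; ring.
have xd : 0 <= x * d ^+ 2 by rewrite mulr_ge0 ?sqr_ge0.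
have qp : q <= p by lra.
have := ln_sub_ge q0 qp.
have -> : artanh (x + d) + artanh (x - d) - 2 * artanh x = (ln p - ln q) / 2.
  by rewrite /p /q !lnM ?posrE ?mulr_gt0// /artanh; lra.
rewrite pq => h.
suff : 4 * (x * d ^+ 2) <= 2 * (4 * x * d ^+ 2) / (p + q) by lra.
rewrite ler_pdivlMr; last lra.
have : p + q <= 2.
  have -> : p + q = 2 * (1 - x ^+ 2) ^+ 2 - 2 * d ^+ 2 * (1 + x ^+ 2) by rewrite /p /q; ring.
  have : 0 <= d ^+ 2 * (1 + x ^+ 2) by rewrite mulr_ge0 ?addr_ge0 ?sqr_ge0.
  have : (1 - x ^+ 2) ^+ 2 <= 1 by rewrite exprn_ile1//; nra.
  lra.
nra.
Qed.

(** Here [x] will be the mean of two successive biases, [d] half their difference, and [T] the value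
    dictated by the block length. Either [x] inherits the gap between [T] and [t], or [d] is large
    enough to pay for it. *)
Lemma gap_ge (R : realFieldType) (t x d T : R) : 0 < t < 1 -> 0 <= T <= t -> 0 <= x ->
  x - T = d * T -> t * (t - T) ^+ 2 / 2 <= t * (t - x) ^+ 2 + 3 / 2 * (x * d ^+ 2).
Proof.
move=> /andP[t0 t1] /andP[T0 Tt] x0 xdT.
have xd0 : 0 <= x * d ^+ 2 by rewrite mulr_ge0 ?sqr_ge0.
have [xT|Tx] := leP x T.
  have h : (t - T) ^+ 2 <= (t - x) ^+ 2 by rewrite lerXn2r ?nnegrE; lra.
  have := ler_wpM2l (ltW t0) h.
  have := mulr_ge0 (ltW t0) (sqr_ge0 (t - T)); lra.
have -> : t - T = (t - x) + d * T by rewrite -xdT; ring.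
have : t * ((d * T) ^+ 2) <= x * d ^+ 2.
  have -> : t * (d * T) ^+ 2 = t * T * T * d ^+ 2 by ring.
  apply: ler_wpM2r; first exact: sqr_ge0.
  apply: le_trans (ltW Tx); apply: ler_piMl => //.
  by apply: mulr_ile1 => //; lra.
have := mulr_ge0 (ltW t0) (sqr_ge0 ((t - x) - d * T)); lra.
Qed.

(** This is [tanh (x / 2)], the fixed point of [y = 1 - expR (- x) * (1 + y)], which is the
    recursion of the biases over equal blocks. *)
Definition tanh_half (R : realType) (x : R) : R := (1 - expR (- x)) / (1 + expR (- x)).

Lemma tanh_half_bounds (R : realType) (x : R) : 0 <= x -> 0 <= tanh_half x < 1.
Proof.
move=> x0; have e0 := expR_gt0 (- x); have e1 : expR (- x) <= 1 by rewrite expR_le1; lra.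
by rewrite /tanh_half divr_ge0 ?ltr_pdivrMr//; lra.
Qed.

Lemma artanh_tanh_half (R : realType) (x : R) : 2 * artanh (tanh_half x) = x.
Proof.
have := expR_gt0 (- x); rewrite /artanh /tanh_half; set P := expR (- x) => P0.
have -> : 1 + (1 - P) / (1 + P) = 2 / (1 + P) by field; lra.
have -> : 1 - (1 - P) / (1 + P) = (2 / (1 + P)) * P by field; lra.
rewrite [ln (_ * P)]lnM ?posrE ?divr_gt0 ?addr_gt0// /P expRK; lra.
Qed.

Lemma tanh_half_sub_ge (R : realType) (x y : R) : 0 <= y -> y <= x -> x <= 1 / 2 ->
  (x - y) / 4 <= tanh_half x - tanh_half y.
Proof.
move=> y0 yx x1; rewrite /tanh_half.
have h : expR (- x) * (1 + (x - y)) <= expR (- y).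
  have -> : expR (- y) = expR (- x) * expR (x - y) by rewrite -expRD; congr expR; ring.
  by rewrite ler_pM2l ?expR_gt0// expR_ge1Dx.
have P2 : 1 / 2 <= expR (- x) by have := expR_ge1Dx (- x); lra.
have e1 : expR (- y) <= 1 by rewrite expR_le1; lra.
have e0 := expR_gt0 (- y).
move: h P2 e1 e0; move: (expR (- x)) (expR (- y)) => P e h P2 e1 e0.
have P1 : P <= 1.
  by apply: le_trans e1; apply: le_trans h; rewrite ler_peMr; lra.
have -> : (1 - P) / (1 + P) - (1 - e) / (1 + e) = 2 * (e - P) / ((1 + P) * (1 + e)).
  by field; apply/andP; split; lra.
rewrite ler_pdivlMr; last by rewrite mulr_gt0//; lra.
apply: (@le_trans _ _ ((x - y) / 4 * ((1 + P) * 2))).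
  by rewrite ler_wpM2l; [|lra|rewrite ler_wpM2l; lra].
have : 1 / 2 * (x - y) <= P * (x - y) by rewrite ler_wpM2r; lra.
have : P * (x - y) <= 1 * (x - y) by rewrite ler_wpM2r; lra.
lra.
Qed.

(* The Lagrange multiplier of the constraint on the sum of the [a_i] is
   [1 - t ^+ 2]; the terms in [ln (1 - y ^+ 2)] telescope. *)
Lemma runs_step (R : realType) (lam a u : R) : 0 < lam <= 1 / 2 -> 0 <= a -> -1 < u < 1 ->
  let t := tanh_half lam in
  let k := 1 - t ^+ 2 in
  let psi y := - (k / 2) * (ln (1 + y) + ln (1 - y)) in
  let v := 1 - expR (- a) * (1 + u) in
  [/\ -1 < v < 1 &
  (1 - expR (- a)) * (1 + u) + psi v - psi u
    <= 2 * t + k * (a - lam) - lam * Num.max 0 (lam - a) ^+ 2 / 128].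
Proof.
move=> /andP[l0 l1] a0 u01 t k psi v; have [u0 u1] := andP u01.
have p0 := expR_gt0 (- a).
have p1 : expR (- a) <= 1 by rewrite expR_le1; lra.
have vE : 1 - v = expR (- a) * (1 + u) by rewrite /v; ring.
have Ea : a = ln (1 + u) - ln (1 - v).
  rewrite vE lnM ?posrE//; last lra.
  rewrite expRK; lra.
have TE : tanh_half a = (1 - expR (- a)) / (1 + expR (- a)) by [].
have uvE : (1 - expR (- a)) * (1 + u) = u + v by rewrite /v; ring.
have tA : 2 * artanh t = lam by exact: artanh_tanh_half.
have /andP[T0 _] := tanh_half_bounds a0.
have /andP[_ t1] := tanh_half_bounds (ltW l0); rewrite -/t in t1.
have tl : lam / 4 <= t.
  have := tanh_half_sub_ge (lexx 0) (ltW l0) l1.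
  have -> : tanh_half 0 = 0 :> R by rewrite /tanh_half oppr0 expR0 subrr mul0r.
  by rewrite !subr0.
have tT : a <= lam -> (lam - a) / 4 <= t - tanh_half a.
  by move=> al; exact: tanh_half_sub_ge.
(* Makes the coefficient [2 * k] at least the [3 / 2] of [gap_ge]. *)
have k0 : 3 / 4 <= k.
  have : t <= 1 / 2.
    have P2 := expR_ge1Dx (- lam).
    rewrite /t /tanh_half ler_pdivrMr; last by have := expR_gt0 (- lam); lra.
    lra.
  move=> t2; have : t * t <= 1 / 2 * (1 / 2) by apply: ler_pM; lra.
  rewrite /k expr2; lra.
move: p0 p1 vE TE uvE Ea; rewrite {}/psi.
move: (expR (- a)) (tanh_half a) T0 tT v => p T T0 tT v p0 p1 vE TE uvE Ea.
rewrite {}uvE.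
have v01 : -1 < v < 1.
  have : 0 < p * (1 + u) by rewrite mulr_gt0//; lra.
  have : p * (1 + u) <= 1 * (1 + u) by rewrite ler_wpM2r//; lra.
  by move=> ? ?; apply/andP; split; lra.
split=> //; have [v0 v1] := andP v01.
have uv : 0 <= u + v.
  have : 0 <= (1 - p) * (1 + u) by rewrite mulr_ge0//; lra.
  lra.
pose x := (u + v) / 2; pose d := (u - v) / 2.
have x01 : 0 <= x < 1 by rewrite /x; apply/andP; split; lra.
have t01 : 0 < t < 1 by apply/andP; split; lra.
have g1 := artanh_tangent x01 t01; rewrite -/k in g1.
have g2 := artanh_midpoint u01 v01 uv; rewrite -/x -/d in g2.
have uvx : u + v = 2 * x by rewrite /x; field.
have xdT : x - T = d * T.
  rewrite TE /x /d; have -> : v = 1 - p * (1 + u) by lra.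
  by field; lra.
move: (x) (d) x01 g1 g2 uvx xdT => {}x {}d /andP[x0 x1] g1 g2 uvx xdT.
have kt : 0 <= k by lra.
(* Twice the tangent bound plus [k] times the midpoint bound, using [2 * artanh t = lam]. *)
have {g1 g2} g : u + v - k * (artanh u + artanh v) + t * (t - x) ^+ 2 + 2 * k * x * d ^+ 2
   <= 2 * t - k * lam.
  have := ler_wpM2l kt g2; rewrite uvx -tA; lra.
suff G : lam * Num.max 0 (lam - a) ^+ 2 / 128 <= t * (t - x) ^+ 2 + 2 * k * x * d ^+ 2.
  (* By [Ea], [psi v - psi u] equals [k * (a - artanh u - artanh v)]. *)
  apply: le_trans (_ : u + v - k * (artanh u + artanh v) + k * a <= _); last lra.
  rewrite /artanh Ea; lra.
have xd0 : 0 <= x * d ^+ 2 by rewrite mulr_ge0 ?sqr_ge0.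
have r1 : 0 <= t * (t - x) ^+ 2 by rewrite mulr_ge0 ?sqr_ge0//; lra.
have r2 : 3 / 2 * (x * d ^+ 2) <= 2 * k * x * d ^+ 2.
  have -> : 2 * k * x * d ^+ 2 = 2 * k * (x * d ^+ 2) by ring.
  by rewrite ler_wpM2r//; lra.
clear Ea vE TE g kt.
have [al|la] := leP a lam; last first.
  rewrite max_l; last lra.
  rewrite expr0n mulr0 mul0r; lra.
rewrite max_r ?subr_ge0//; move: (tT al) => {}tT.
have main : t * (t - T) ^+ 2 / 2 <= t * (t - x) ^+ 2 + 3 / 2 * (x * d ^+ 2).
  by apply: gap_ge => //; rewrite T0; lra.
(* With the factor [1 / 2] of [main], the constant is [1 / 4 * (1 / 4) ^ 2 / 2 = 1 / 128]. *)
have : lam / 4 * ((lam - a) / 4) ^+ 2 <= t * (t - T) ^+ 2.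
  apply: ler_pM => //; [lra|exact: sqr_ge0|].
  by apply: lerXn2r => //; rewrite nnegrE; lra.
lra.
Qed.

(** * Expectations over one trace *)

(** A normalized positive linear functional. Both [traceE] and [countE] are instances, so
    Chebyshev's inequality is proved once for both. *)
Definition expectation (R : realType) (T : Type) (E : (T -> R) -> R) : Prop :=
  [/\ forall f g, f =1 g -> E f = E g,
      forall a f g, E (fun x => a * f x + g x) = a * E f + E g,
      forall f, (forall x, 0 <= f x) -> 0 <= E f
    & E (fun=> 1) = 1].

Section Expectation.
Variables (R : realType) (T : Type) (E : (T -> R) -> R).
Hypothesis HE : expectation E.

Lemma exp_ext f g : f =1 g -> E f = E g. Proof. by case: HE => h _ _ _; exact: h. Qed.

Lemma exp_lin a f g : E (fun x => a * f x + g x) = a * E f + E g.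
Proof. by case: HE. Qed.

Lemma exp_ge0 f : (forall x, 0 <= f x) -> 0 <= E f.
Proof. by case: HE => _ _ h _; exact: h. Qed.

Lemma exp_cst c : E (fun=> c) = c.
Proof.
case: HE => _ _ _ h1.
have h0 : E (fun=> 0) = 0.
  have := exp_lin (-1) (fun=> 0) (fun=> 0).
  rewrite (exp_ext (g := fun=> 0)) => [|x]; lra.
rewrite (exp_ext (g := fun=> c * 1 + 0)) => [|x]; last lra.
rewrite (exp_lin c (fun=> 1) (fun=> 0)) h1 h0; lra.
Qed.

Lemma expD f g : E (fun x => f x + g x) = E f + E g.
Proof.
rewrite (exp_ext (g := fun x => 1 * f x + g x)) => [|x]; last by rewrite mul1r.
by rewrite exp_lin mul1r.
Qed.

Lemma expZ a f : E (fun x => a * f x) = a * E f.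
Proof.
rewrite (exp_ext (g := fun x => a * f x + 0)) => [|x]; last by rewrite addr0.
by rewrite (exp_lin a f (fun=> 0)) exp_cst addr0.
Qed.

Lemma expB f g : E (fun x => f x - g x) = E f - E g.
Proof.
rewrite (exp_ext (g := fun x => -1 * g x + f x)) => [|x]; last lra.
by rewrite exp_lin mulN1r addrC.
Qed.

Lemma exp_le f g : (forall x, f x <= g x) -> E f <= E g.
Proof. by move=> fg; rewrite -subr_ge0 -expB exp_ge0// => x; rewrite subr_ge0. Qed.

Lemma exp_norm_le f c : (forall x, `|f x| <= c) -> `|E f| <= c.
Proof.
move=> fc; rewrite ler_norml -{1}(exp_cst (- c)) -{2}(exp_cst c).
by rewrite !exp_le// => x; have := fc x; rewrite ler_norml => /andP[].
Qed.

Lemma exp_sqr_shift f c : E (fun x => (f x - c) ^+ 2) =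
  E (fun x => (f x - E f) ^+ 2) + (E f - c) ^+ 2.
Proof.
set m := E f.
rewrite (exp_ext (g := fun x => (f x - m) ^+ 2 + (2 * (m - c) * (f x - m) + (m - c) ^+ 2)));
  last by move=> x; ring.
rewrite expD; congr (_ + _).
rewrite (exp_lin _ (fun x => f x - m) (fun=> (m - c) ^+ 2)) exp_cst.
rewrite (expB f (fun=> m)) exp_cst -/m; ring.
Qed.

Lemma exp_neg (b : pred T) : E (fun x => (~~ b x)%:R) = 1 - E (fun x => (b x)%:R).
Proof.
have := expB (fun=> 1) (fun x => (b x)%:R); rewrite exp_cst => <-.
by apply: exp_ext => x; case: (b x); rewrite ?subr0 ?subrr.
Qed.

Lemma chebyshev (b : pred T) f m s : 0 < s -> (forall x, b x -> s ^+ 2 <= (f x - m) ^+ 2) ->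
  E (fun x => (b x)%:R) <= E (fun x => (f x - m) ^+ 2) / s ^+ 2.
Proof.
move=> s0 h; rewrite ler_pdivlMr ?exprn_gt0// mulrC -expZ; apply: exp_le => x.
by case: (boolP (b x)) => [/h|_]; rewrite ?mulr1// mulr0 sqr_ge0.
Qed.

End Expectation.

(* [traceE rho x f] is the expectation of [f w] over a random trace [w] of [x]. *)
Fixpoint traceE (R : realType) (rho : R) (x : seq bool) (f : seq bool -> R) : R :=
  if x is a :: x' then
    rho * traceE rho x' (fun w => f (a :: w)) + (1 - rho) * traceE rho x' f
  else f [::].

Lemma traceE_expectation (R : realType) (rho : R) (x : seq bool) :
  0 <= rho <= 1 -> expectation (traceE rho x).
Proof.
move=> /andP[r0 r1]; elim: x => [|a x [h1 h2 h3 h4]]; first by split=> //= f g; apply.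
split=> /= [f g fg|c f g|f f0|].
- by rewrite (h1 _ _ fg) (h1 (fun w => f (a :: w)) (fun w => g (a :: w))).
- rewrite (h2 c f g) (h2 c (fun w => f (a :: w)) (fun w => g (a :: w))); ring.
- by rewrite addr_ge0// mulr_ge0// ?subr_ge0// h3.
- rewrite h4; ring.
Qed.

Lemma traceE_cat (R : realType) (rho : R) (x y : seq bool) f :
  0 <= rho <= 1 ->
  traceE rho (x ++ y) f = traceE rho x (fun u => traceE rho y (fun v => f (u ++ v))).
Proof. by move=> r01; elim: x f => //= a x IH f; rewrite !IH. Qed.

(* Efron-Stein, peeling off one symbol of [x] at a time. *)
Lemma traceE_var_le (R : realType) (rho L : R) (x : seq bool) f :
  0 <= rho <= 1 -> (forall u a v, `|f (u ++ a :: v) - f (u ++ v)| <= L) ->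
  traceE rho x (fun w => (f w - traceE rho x f) ^+ 2) <= rho * (size x)%:R * L ^+ 2.
Proof.
move=> r01 hf; have [r0 r1] := andP r01.
elim: x f hf => [|a x IH] f hf /=; first by rewrite subrr expr0n mulr0 mul0r.
have HE := traceE_expectation x r01.
set m1 := traceE rho x (fun w => f (a :: w)); set m0 := traceE rho x f.
set m := rho * m1 + (1 - rho) * m0.
have /= E1 := exp_sqr_shift HE (fun w => f (a :: w)) m.
rewrite E1 (exp_sqr_shift HE f) -/m1 -/m0 => {E1}.
have := IH f hf; rewrite -/m0 => h0.
have := IH (fun w => f (a :: w)) (fun u b v => hf (a :: u) b v); rewrite -/m1 => h1.
have hm : (m1 - m0) ^+ 2 <= L ^+ 2.
  have h : `|m1 - m0| <= L.
    by rewrite -(expB HE); apply: exp_norm_le => // w; exact: (hf [::] a w).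
  have L0 : 0 <= L by apply: le_trans h.
  by rewrite -(real_normK (num_real _)) lerXn2r ?nnegrE.
(* Law of total variance: the conditional means add [rho * (1 - rho) * (m1 - m0) ^+ 2]. *)
have e1 : m1 - m = (1 - rho) * (m1 - m0) by rewrite /m; ring.
have e0 : m0 - m = - rho * (m1 - m0) by rewrite /m; ring.
rewrite e1 e0.
set V1 := traceE _ _ _ in h1 *; set V0 := traceE _ _ _ in h0 *.
have k1 := ler_wpM2l r0 h1.
have k2 : 0 <= 1 - rho by lra.
have k3 := ler_wpM2l k2 h0.
have k4 : rho * (1 - rho) * (m1 - m0) ^+ 2 <= rho * L ^+ 2.
  apply: ler_pM => //; [by rewrite mulr_ge0|exact: sqr_ge0|].
  by apply: ler_piMr => //; lra.
rewrite -natr1; lra.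
Qed.

(** * From sums over retention patterns to [traceE] *)

Lemma sum_tuple_cons (R : realType) (N : nat) (F : N.+1.-tuple bool -> R) :
  \sum_t F t = \sum_(t : N.-tuple bool) F [tuple of true :: t]
             + \sum_(t : N.-tuple bool) F [tuple of false :: t].
Proof.
rewrite (reindex (fun p : bool * N.-tuple bool => [tuple of p.1 :: p.2])) /=.
  by rewrite -(pair_big predT predT (fun b (t : N.-tuple bool) => F [tuple of b :: t]))
    /= big_bool.
exists (fun t => (thead t, [tuple of behead t])) => [[b t] _|t _] /=.
  by congr (_, _); apply/val_inj.
by rewrite -tuple_eta.
Qed.

Lemma sum_retention_pr (R : realType) (rho : R) (N : nat) (x : seq bool) f : size x = N ->
  \sum_(m : N.-tuple bool) retention_pr rho m * f (mask m x) = traceE rho x f.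
Proof.
elim: x N f => [|a x IH] [|N]// f => [_|[sx]] /=.
  rewrite (big_pred1 [tuple]) /= => [|t]; last by apply/esym/eqP; exact: tuple0.
  by rewrite /retention_pr big_ord0 mul1r.
rewrite sum_tuple_cons -(IH N)// -(IH N)// !mulr_sumr.
by congr (_ + _); apply: eq_bigr => t _; rewrite /retention_pr big_ord_recl mulrA tnth0 /=;
  congr (_ * _ * _); apply: eq_bigr => i _; rewrite tnthS.
Qed.

Lemma traces_pr1 (R : realType) (rho : R) (N : nat) (x : N.-tuple bool) (A : pred (seq bool)) :
  traces_pr rho x (fun w : 1.-tuple (seq bool) => A (tnth w ord0)) =
  traceE rho x (fun w => (A w)%:R).
Proof.
rewrite -(@sum_retention_pr _ _ N) ?size_tuple// /traces_pr.
rewrite (reindex (fun m : N.-tuple bool => [ffun _ : 'I_1 => m])) /=; last first.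
  exists (fun m => m ord0) => [m _|m _]; first by rewrite ffunE.
  by apply/ffunP => i; rewrite ffunE (ord1 i).
rewrite big_mkcond; apply: eq_bigr => m _ /=.
rewrite tnth_mktuple big_ord1 !ffunE.
by case: (A _); rewrite ?mulr1 ?mulr0.
Qed.

Lemma trace_tester1 (R : realType) (rho : R) (N : nat) (Psi1 Psi2 : {set N.-tuple bool})
    (A : pred (seq bool)) : 0 <= rho <= 1 ->
  (forall x, x \in Psi1 -> traceE rho x (fun w => (~~ A w)%:R) <= 1 / 3) ->
  (forall x, x \in Psi2 -> traceE rho x (fun w => (A w)%:R) <= 1 / 3) ->
  trace_tester Psi1 Psi2 rho (2%:R / 3%:R) (fun w : 1.-tuple (seq bool) => A (tnth w ord0)).
Proof.
move=> r01 h1 h2; split=> x xP.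
  have := h1 x xP; rewrite traces_pr1 exp_neg; first lra.
  exact: traceE_expectation.
have := h2 x xP; rewrite (traces_pr1 _ _ (predC A)) exp_neg; first lra.
exact: traceE_expectation.
Qed.

(** * Number of runs of a short trace *)

Definition sym_sign (R : realType) (a : bool) : R := if a then 1 else -1.

Definition head_sign (R : realType) (w : seq bool) : R :=
  if w is a :: _ then sym_sign R a else 0.

(* Twice the number of runs of [w], minus one if [w] is nonempty. *)
Fixpoint runs_stat (R : realType) (w : seq bool) : R :=
  if w is a :: w' then runs_stat R w' + (1 - sym_sign R a * head_sign R w') else 0.

(** Only the terms of the inserted symbol and of its left neighbour change. *)
Lemma runs_stat_insert (R : realType) u a v :
  `|runs_stat R (u ++ a :: v) - runs_stat R (u ++ v)| <= 4.
Proof.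
have s1 b : `|sym_sign R b| <= 1 by case: b; rewrite /= ?normrN normr1.
have h1 w : `|head_sign R w| <= 1 by case: w => [|b w] //=; rewrite normr0.
have p1 (x y : R) : `|x| <= 1 -> `|y| <= 1 -> `|x * y| <= 1.
  by move=> ? ?; rewrite normrM mulr_ile1.
case: u => [|b u] /=.
  have := p1 _ _ (s1 a) (h1 v); rewrite !ler_norml; lra.
elim: u b => [|c u IH] b /=.
  have := p1 _ _ (s1 a) (h1 v); have := p1 _ _ (s1 b) (h1 v).
  have := p1 _ _ (s1 b) (s1 a); rewrite !ler_norml; lra.
have -> // (x y z : R) : x + z - (y + z) = x - y by ring.
Qed.

(* Probability that the trace of [alternating a ls] starts with [a], minus the
   probability that it starts with [~~ a], for deletion probability [q]. *)
Fixpoint head_bias (R : realType) (q : R) (ls : seq nat) : R :=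
  if ls is l :: ls' then 1 - q ^+ l * (1 + head_bias q ls') else 0.

Fixpoint mean_runs (R : realType) (q : R) (ls : seq nat) : R :=
  if ls is l :: ls' then mean_runs q ls' + (1 - q ^+ l) * (1 + head_bias q ls') else 0.

Lemma traceE_head_sign (R : realType) (rho : R) a ls : 0 <= rho <= 1 ->
  traceE rho (alternating a ls) (head_sign R) = sym_sign R a * head_bias (1 - rho) ls.
Proof.
move=> r01; elim: ls a => [|l ls IH] a /=; first by rewrite mulr0.
elim: l => [|l IHl] /=; first by rewrite IH expr0; case: (a) => /=; ring.
rewrite IHl (exp_cst (traceE_expectation _ r01)) exprS; ring.
Qed.

(** Among the retained symbols of a block only the last one contributes, with expectation
    [1 + head_bias] of the later blocks; such a symbol exists with probability [1 - q ^ l]. *)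
Lemma traceE_runs_stat (R : realType) (rho : R) a ls : 0 <= rho <= 1 ->
  traceE rho (alternating a ls) (runs_stat R) = mean_runs (1 - rho) ls.
Proof.
move=> r01; elim: ls a => [|l ls IH] a //=.
elim: l => [|l IHl]; first by rewrite /= IH expr0; ring.
rewrite -[nseq l.+1 a ++ _]/(a :: alternating a (l :: ls)) /=.
have HE := traceE_expectation (nseq l a ++ alternating (~~ a) ls) r01.
rewrite (expD HE (runs_stat R)) (expB HE (fun=> 1)) (exp_cst HE) (expZ HE) IHl.
have := traceE_head_sign a (l :: ls) r01; rewrite /= => ->.
have s2 : sym_sign R a * sym_sign R a = 1 by case: (a) => /=; ring.
rewrite [sym_sign R a * (_ * _)]mulrA s2 exprS; ring.
Qed.

(** Summing [runs_step] over the blocks telescopes [psi], which vanishes at the bias 0 of the empty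
    list and is nonnegative at the front, where it is dropped. *)
Lemma mean_runs_le (R : realType) (lam tau : R) ls : 0 < lam <= 1 / 2 -> 0 <= tau ->
  mean_runs (expR (- tau)) ls <=
  \sum_(l <- ls) (2 * tanh_half lam + (1 - tanh_half lam ^+ 2) * (l%:R * tau - lam)
     - lam * Num.max 0 (lam - l%:R * tau) ^+ 2 / 128).
Proof.
move=> hl tau0; set t := tanh_half lam.
set k := 1 - t ^+ 2.
pose psi y := - (k / 2) * (ln (1 + y) + ln (1 - y)).
set b := head_bias (expR (- tau)); set m := mean_runs _.
suff [b1 h] : -1 < b ls < 1 /\ m ls + psi (b ls) <=
    \sum_(l <- ls) (2 * t + k * (l%:R * tau - lam)
     - lam * Num.max 0 (lam - l%:R * tau) ^+ 2 / 128).
  apply: le_trans h; rewrite lerDl /psi mulNr -mulrN mulr_ge0//.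
    have /andP[l0 _] := hl; have /andP[t0 t1] := tanh_half_bounds (ltW l0).
    by rewrite divr_ge0// subr_ge0 exprn_ile1// ltW.
  rewrite -lnM ?posrE; [|lra..].
  rewrite oppr_ge0 ln_le0//; have := sqr_ge0 (b ls); lra.
elim: ls => [|l ls [b1 IH]].
  by rewrite big_nil /b /m /psi /= addr0 subr0 ln1; split; lra.
have lt0 : 0 <= l%:R * tau by rewrite mulr_ge0.
have [] := runs_step hl lt0 b1.
rewrite -/t -/k big_cons.
have -> : expR (- (l%:R * tau)) = expR (- tau) ^+ l by rewrite -mulrN expRM_natl.
move=> v1 h; split; first exact: v1.
rewrite /m /b /=; move: h IH; rewrite /m /b /psi; lra.
Qed.

(** As [t] is the fixed point of the bias recursion, each block adds [2 * t] up to a telescoping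
    boundary term. *)
Lemma mean_runs_uniform (R : realType) (q : R) (n L : nat) : 0 <= q ->
  let: t := (1 - q ^+ L) / (1 + q ^+ L) in
  mean_runs q (nseq n L) = 2 * n%:R * t - t * head_bias q (nseq n L).
Proof.
move=> q0; set t := _ / _; elim: n => [|n IH] /=; first by ring.
rewrite IH -natr1 /t; field.
by have := exprn_ge0 L q0; lra.
Qed.

Lemma head_bias_le1 (R : realType) (q : R) ls : 0 <= q <= 1 -> -1 <= head_bias q ls <= 1.
Proof.
move=> /andP[q0 q1]; elim: ls => [|l ls /andP[h0 h1]] /=; first lra.
have := exprn_ge0 l q0; have : q ^+ l <= 1 by rewrite exprn_ile1.
set p := q ^+ l => p1 p0.
have : 0 <= p * (1 + head_bias q ls) by rewrite mulr_ge0//; lra.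
have : p * (1 + head_bias q ls) <= 1 * 2 by rewrite ler_pM//; lra.
lra.
Qed.

(** Cauchy-Schwarz, from nonnegativity of the empirical variance. *)
Lemma sum_sqr_ge (R : realFieldType) (T : Type) (s : seq T) (f : T -> R) :
  (\sum_(x <- s) f x) ^+ 2 <= (size s)%:R * \sum_(x <- s) f x ^+ 2.
Proof.
set S := \sum_(x <- s) f x; set Q := \sum_(x <- s) _.
case: (posnP (size s)) => [/size0nil s0|s0].
  by rewrite /S /Q s0 !big_nil mulr0 expr0n.
have n0 : 0 < (size s)%:R :> R by rewrite ltr0n.
set n := (size s)%:R in n0 *.
have : 0 <= \sum_(x <- s) (f x - S / n) ^+ 2 by apply: sumr_ge0 => x _; exact: sqr_ge0.
have -> : \sum_(x <- s) (f x - S / n) ^+ 2 = Q - S ^+ 2 / n.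
  transitivity (\sum_(x <- s) (f x ^+ 2 - 2 * (S / n) * f x + (S / n) ^+ 2)).
    by apply: eq_bigr => x _; ring.
  rewrite big_split sumrB -mulr_sumr /= -/S -/Q big_const_seq count_predT iter_addr_0.
  rewrite -[_ *+ size s]mulr_natr -/n; field; lra.
by rewrite subr_ge0 ler_pdivrMr// mulrC.
Qed.

(** The deviations sum to zero, so the short blocks carry half of the total absolute deviation; only
    their deficit is penalized in [mean_runs_le]. *)
Lemma sum_dev_ge (R : realType) (n : nat) (ls : seq nat) (lam tau D : R) : size ls = n ->
  (sumn ls)%:R * tau = n%:R * lam -> 0 <= D ->
  D <= \sum_(l <- ls) `|l%:R * tau - lam| ->
  D ^+ 2 <= 4 * n%:R * \sum_(l <- ls) Num.max 0 (lam - l%:R * tau) ^+ 2.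
Proof.
move=> sls hsum D0 hD.
set S := \sum_(l <- ls) Num.max 0 (lam - l%:R * tau).
have hS : D <= 2 * S.
  apply: le_trans hD _.
  have -> : \sum_(l <- ls) `|l%:R * tau - lam| =
      \sum_(l <- ls) (l%:R * tau - lam) + 2 * S.
    rewrite mulr_sumr -big_split; apply: eq_bigr => l _ /=.
    case: (leP (l%:R * tau) lam) => h.
      rewrite max_r; last lra.
      rewrite ler0_norm; lra.
    rewrite max_l; last lra.
    rewrite gtr0_norm; lra.
  rewrite sumrB -mulr_suml -natr_sum -sumnE hsum big_const_seq count_predT iter_addr_0 sls.
  by rewrite mulr_natl subrr add0r.
have := sum_sqr_ge ls (fun l => Num.max 0 (lam - l%:R * tau)); rewrite sls -/S => h.
have : D ^+ 2 <= (2 * S) ^+ 2 by rewrite lerXn2r ?nnegrE//; apply: le_trans hS.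
lra.
Qed.

(** [s] is the loss of a far string in the expected statistic. The variance is at most [16 * M], and
    Chebyshev at distance [(s - 1) / 2] gives the condition [192 * M <= (s - 1) ^+ 2]. *)
Lemma sparse_tester (R : realType) (N n L : nat) (M eps s : R) :
  N = (n * L)%N -> (0 < N)%N -> 0 < M -> 2 * M <= n%:R -> 0 < eps ->
  s = eps ^+ 2 * M ^+ 3 / (512 * n%:R ^+ 2) ->
  1 <= s -> 192 * M <= (s - 1) ^+ 2 ->
  exists rho : R, exists A : pred (seq bool),
  [/\ 0 <= rho <= 1, rho * N%:R <= M,
      forall a, traceE rho (alternating a (nseq n L)) (fun w => (~~ A w)%:R) <= 1 / 3
    & forall a ls, size ls = n -> sumn ls = N ->
        eps * N%:R <= \sum_(l <- ls) `|l%:R - L%:R| ->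
        traceE rho (alternating a ls) (fun w => (A w)%:R) <= 1 / 3].
Proof.
move=> NE N0 M0 Mn e0 sE s1 sM.
have n0 : (0 < n)%N by move: N0; rewrite NE muln_gt0 => /andP[].
have N0' : 0 < N%:R :> R by rewrite ltr0n.
have n0' : 0 < n%:R :> R by rewrite ltr0n.
pose tau := M / N%:R; pose lam := M / n%:R.
have tau0 : 0 < tau by rewrite divr_gt0.
have lamE : L%:R * tau = lam.
  by rewrite /lam /tau NE natrM; field; rewrite gt_eqF//= pnatr_eq0 -lt0n;
    move: N0; rewrite NE muln_gt0 => /andP[].
have lam01 : 0 < lam <= 1 / 2 by rewrite /lam divr_gt0// ler_pdivrMr//; lra.
have [lam0 lam1] := andP lam01.
pose t := tanh_half lam; pose q := expR (- tau).
have q0 : 0 < q by exact: expR_gt0.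
have q1 : q <= 1 by rewrite /q expR_le1; lra.
have r01 : 0 <= 1 - q <= 1 by lra.
have qE : 1 - (1 - q) = q by ring.
have /andP[t0 t1] : 0 <= t < 1 := tanh_half_bounds (ltW lam0).
have rhoN : (1 - q) * N%:R <= M.
  have : 1 - q <= tau by have := expR_ge1Dx (- tau); rewrite -/q; lra.
  by move=> h; rewrite -(@ler_pdivlMr _ N%:R)// in h *.
(* Midway between [2 * n * t - 1], below the uniform mean, and [2 * n * t - s], above the far
   means. *)
pose thr := 2 * n%:R * t - (s + 1) / 2.
have var x : traceE (1 - q) x
    (fun w => (runs_stat R w - traceE (1 - q) x (runs_stat R)) ^+ 2) <= (1 - q) * (size x)%:R * 16.
  have := traceE_var_le x r01 (@runs_stat_insert R).
  by have -> : 4 ^+ 2 = 16 :> R by ring.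
have cheb (x : seq bool) (A : pred (seq bool)) : size x = N ->
    (forall w, A w -> (s - 1) / 2 <= `|runs_stat R w - traceE (1 - q) x (runs_stat R)|) ->
    traceE (1 - q) x (fun w => (A w)%:R) <= 1 / 3.
  move=> sx hA.
  have s1' : 1 < s.
    rewrite ltNge; apply/negP => s1'; have e : s - 1 = 0 by lra.
    move: sM; rewrite e expr0n /=; lra.
  have s0 : 0 < (s - 1) / 2 by lra.
  apply: le_trans (chebyshev (traceE_expectation x r01)
    (m := traceE (1 - q) x (runs_stat R)) s0 _) _.
    move=> w /hA h; rewrite -[leRHS](real_normK (num_real _)).
    by apply: lerXn2r; [rewrite nnegrE ltW|rewrite nnegrE normr_ge0|exact: h].
  rewrite ler_pdivrMr ?exprn_gt0//.
  apply: le_trans (var x) _; rewrite sx; lra.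
exists (1 - q), (fun w => thr < runs_stat R w); split=> // [a|a ls sls sumls dls].
  apply: (cheb _ (fun w => ~~ (thr < runs_stat R w))) => [|w].
    by rewrite size_alternating sumn_nseq mulnC NE.
  rewrite -leNgt => h; rewrite traceE_runs_stat// qE.
  have qL : q ^+ L = expR (- lam) by rewrite /q -expRM_natl mulrN lamE.
  rewrite (mean_runs_uniform _ _ (ltW q0)) qL -[(1 - expR (- lam)) / _]/t.
  have b1 : head_bias q (nseq n L) <= 1.
    by have /andP[] := head_bias_le1 (nseq n L) (introT andP (conj (ltW q0) q1)).
  have : t * head_bias q (nseq n L) <= 1.
    apply: le_trans (_ : t * 1 <= _); [exact: ler_wpM2l|lra].
  move=> tb; rewrite ler_normr; apply/orP; right; move: h; rewrite /thr; lra.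
apply: cheb => [|w h]; first by rewrite size_alternating.
rewrite ler_normr; apply/orP; left; rewrite traceE_runs_stat// qE.
suff : mean_runs q ls <= 2 * n%:R * t - s by move: h; rewrite /thr; lra.
apply: le_trans (mean_runs_le ls lam01 (ltW tau0)) _; rewrite -/t.
have hs : (sumn ls)%:R * tau = n%:R * lam.
  by rewrite sumls /tau /lam ![_ * (M / _)]mulrC !divfK ?gt_eqF.
have eM : 0 <= eps * M by rewrite mulr_ge0// ltW.
have := sum_dev_ge sls hs eM.
set S2 := \sum_(l <- ls) Num.max _ _ ^+ 2 => hdev.
have {}hdev : (eps * M) ^+ 2 <= 4 * n%:R * S2.
  apply: hdev.
  have -> : \sum_(l <- ls) `|l%:R * tau - lam| = (\sum_(l <- ls) `|l%:R - L%:R|) * tau.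
    rewrite mulr_suml; apply: eq_bigr => l _.
    by rewrite -lamE -mulrBl normrM (gtr0_norm tau0).
  have -> : eps * M = eps * N%:R * tau by rewrite /tau -mulrA [N%:R * _]mulrC divfK ?gt_eqF.
  by rewrite ler_wpM2r// ltW.
have cst (c : R) : \sum_(l <- ls) c = n%:R * c.
  by rewrite big_const_seq count_predT iter_addr_0 sls mulr_natl.
rewrite sumrB big_split /= cst.
have -> : \sum_(l <- ls) (1 - t ^+ 2) * (l%:R * tau - lam) = 0.
  by rewrite -mulr_sumr sumrB cst -mulr_suml -natr_sum -sumnE hs subrr mulr0.
rewrite -mulr_suml -mulr_sumr -/S2.
have : s <= lam * S2 / 128.
  rewrite sE /lam.
  have E (c : R) : 0 < c -> eps ^+ 2 * M ^+ 3 / (512 * c ^+ 2) =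
     (M / c) * ((eps * M) ^+ 2 / (4 * c)) / 128 by move=> c0; field; rewrite gt_eqF.
  rewrite E//.
  have h4 : (eps * M) ^+ 2 / (4 * n%:R) <= S2.
    have n4 : 0 < 4 * n%:R :> R by exact: mulr_gt0.
    by rewrite ler_pdivrMr// [leRHS]mulrC.
  apply: ler_wpM2r; first by rewrite invr_ge0.
  by apply: ler_wpM2l => //; exact: ltW.
lra.
Qed.

(** * Run lengths of a long trace *)

(* [countE rho ls F] is the expectation of [F ks], where the [i]-th entry of [ks]
   is the number of symbols retained from a block of length [nth 0 ls i]. *)
Fixpoint countE (R : realType) (rho : R) (ls : seq nat) (F : seq nat -> R) : R :=
  if ls is l :: ls' then
    traceE rho (nseq l true) (fun w => countE rho ls' (fun ks => F (size w :: ks)))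
  else F [::].

Lemma countE_expectation (R : realType) (rho : R) (ls : seq nat) :
  0 <= rho <= 1 -> expectation (countE rho ls).
Proof.
move=> r01; elim: ls => [|l ls [h1 h2 h3 h4]]; first by split=> //= f g; apply.
have HE := traceE_expectation (nseq l true) r01.
split=> /= [f g fg|c f g|f f0|].
- by apply: (exp_ext HE) => w; exact: h1.
- rewrite -(exp_lin HE); apply: (exp_ext HE) => w.
  exact: (h2 c (fun ks => f (size w :: ks)) (fun ks => g (size w :: ks))).
- by apply: (exp_ge0 HE) => w; exact: h3.
- by rewrite h4 (exp_cst HE).
Qed.

Lemma countE_le (R : realType) (rho : R) (ls : seq nat) F G : 0 <= rho <= 1 ->
  (forall ks, size ks = size ls -> F ks <= G ks) -> countE rho ls F <= countE rho ls G.
Proof.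
move=> r01; elim: ls F G => [|l ls IH] F G /= FG; first exact: FG.
apply: (exp_le (traceE_expectation _ r01)) => w.
by apply: IH => ks sks; apply: FG; rewrite /= sks.
Qed.

Lemma traceE_nseq (R : realType) (rho : R) (l : nat) (a : bool) f :
  traceE rho (nseq l a) f = traceE rho (nseq l true) (fun w => f (nseq (size w) a)).
Proof. by elim: l f => //= l IH f; rewrite IH [in X in _ + X = _]IH. Qed.

Lemma traceE_alternating (R : realType) (rho : R) a (ls : seq nat) f : 0 <= rho <= 1 ->
  traceE rho (alternating a ls) f = countE rho ls (fun ks => f (alternating a ks)).
Proof.
move=> r01; elim: ls a f => //= l ls IH a f.
rewrite traceE_cat// traceE_nseq; apply: (exp_ext (traceE_expectation _ r01)) => w.
by rewrite IH.
Qed.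

(** Union bound over the blocks. *)
Lemma count_zero_le (R : realType) (rho : R) (ls : seq nat) : 0 <= rho <= 1 ->
  countE rho ls (fun ks => (~~ all (leq 1) ks)%:R) <= \sum_(l <- ls) (1 - rho) ^+ l.
Proof.
move=> r01; elim: ls => [|l ls IH] /=; first by rewrite big_nil.
have HE := traceE_expectation (nseq l true) r01.
have HC := countE_expectation ls r01.
rewrite big_cons.
apply: (@le_trans _ _ (traceE rho (nseq l true) (fun w =>
   (size w == 0)%:R + countE rho ls (fun ks => (~~ all (leq 1) ks)%:R)))).
  apply: (exp_le HE) => w; rewrite -[X in X + _](exp_cst HC) -(expD HC).
  apply: (exp_le HC) => ks; rewrite lt0n.
  by case: (_ == _); case: (all _ _); rewrite /= ?addr0 ?add0r ?lexx ?ler01 // lerDl ler01.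
rewrite (expD HE) (exp_cst HE) lerD//.
elim: l {HE} => [|l IHl] /=; first by rewrite expr0.
have HE := traceE_expectation (nseq l true) r01.
rewrite (exp_cst HE) mulr0 add0r exprS ler_wpM2l//; lra.
Qed.

Definition centred (R : realType) (rho : R) (l : nat) (w : seq bool) : R :=
  (size w)%:R - rho * l%:R.

(* Twice the second elementary symmetric function of the centred retention
   bits; hence it is orthogonal to [1] and to [centred rho l]. *)
Definition centred2 (R : realType) (rho : R) (l : nat) (w : seq bool) : R :=
  centred rho l w ^+ 2 - (1 - 2 * rho) * centred rho l w - l%:R * (rho * (1 - rho)).

(** By orthogonality the second moment is diagonal in the coefficients. Peeling off one symbol keeps
    [al] and shifts [be] and [ga], so the induction runs over all [be] and [ga]. *)
Lemma binomial_moments (R : realType) (rho : R) (l : nat) (al be ga : R) : 0 <= rho <= 1 ->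
  let f w := al * centred2 rho l w + be * centred rho l w + ga in
  traceE rho (nseq l true) f = ga /\
  traceE rho (nseq l true) (fun w => f w ^+ 2) =
    al ^+ 2 * (2 * l%:R * (l%:R - 1) * (rho * (1 - rho)) ^+ 2)
    + be ^+ 2 * (l%:R * (rho * (1 - rho))) + ga ^+ 2.
Proof.
move=> r01; elim: l be ga => [|l IH] be ga f.
  by rewrite /f /centred2 /centred /=; split; ring.
have HE := traceE_expectation (nseq l true) r01.
have := IH (2 * al * (1 - rho) + be) (be * (1 - rho) + ga).
have := IH (be - 2 * al * rho) (ga - be * rho).
set f0 := fun w => _ + _ + (ga - _); move=> /= [h0 k0].
set f1 := fun w => _ + _ + (_ + ga); move=> /= [h1 k1].
have e1 w : f (true :: w) = f1 w by rewrite /f /f1 /centred2 /centred /= -!natr1; ring.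
have e0 w : f w = f0 w by rewrite /f /f0 /centred2 /centred -!natr1; ring.
split=> /=.
  by rewrite (exp_ext HE e1) (exp_ext HE e0) h1 h0; ring.
rewrite (exp_ext HE (g := fun w => f1 w ^+ 2)) => [|w]; last by rewrite e1.
rewrite (exp_ext HE (f := fun w => f w ^+ 2) (g := fun w => f0 w ^+ 2)) => [|w];
  last by rewrite e0.
rewrite k1 k0 -!natr1; ring.
Qed.

(** Variances of independent counts add; the last term is the squared bias relative to [c]. *)
Lemma countE_sum_sqr (R : realType) (rho : R) (z : nat -> R) (m v : nat -> R) ls c :
  0 <= rho <= 1 ->
  (forall l, traceE rho (nseq l true) (fun w => z (size w)) = m l) ->
  (forall l, traceE rho (nseq l true) (fun w => (z (size w) - m l) ^+ 2) = v l) ->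
  countE rho ls (fun ks => (\sum_(k <- ks) z k - c) ^+ 2) =
    \sum_(l <- ls) v l + (\sum_(l <- ls) m l - c) ^+ 2.
Proof.
move=> r01 hm hv; elim: ls c => [|l ls IH] c /=; first by rewrite !big_nil; ring.
have HE := traceE_expectation (nseq l true) r01.
rewrite (exp_ext HE (g := fun w => \sum_(l <- ls) v l +
   (z (size w) - (c - \sum_(l <- ls) m l)) ^+ 2)) => [|w]; last first.
  have HC := countE_expectation ls r01.
  rewrite (exp_ext HC (g := fun ks => (\sum_(k <- ks) z k - (c - z (size w))) ^+ 2));
    last by move=> ks; rewrite big_cons; congr (_ ^+ 2); ring.
  rewrite IH; congr (_ + _ ^+ 2); ring.
rewrite (expD HE) (exp_cst HE) (exp_sqr_shift HE (fun w => z (size w))) hm hv !big_cons.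
by rewrite addrA [v l + _]addrC; congr (_ + _ ^+ 2); ring.
Qed.

(** The linear correction makes the noise part of the mean [rho ^ 2 * l], whose sum depends only on
    the total length. It also makes the coefficient of [centred] equal to [2 * (rho * l - mu)], zero
    on uniform strings. *)
Definition count_stat (R : realType) (rho mu : R) (k : nat) : R :=
  (k%:R - mu) ^+ 2 - (1 - 2 * rho) * k%:R.

Lemma countE_count_stat (R : realType) (rho mu : R) ls :
  0 <= rho <= 1 ->
  let m l := (rho * l%:R - mu) ^+ 2 + rho ^+ 2 * l%:R in
  countE rho ls (fun ks =>
    (\sum_(k <- ks) count_stat rho mu k - \sum_(l <- ls) m l) ^+ 2) =
  \sum_(l <- ls) (2 * l%:R * (l%:R - 1) * (rho * (1 - rho)) ^+ 2
     + 4 * (rho * l%:R - mu) ^+ 2 * (l%:R * (rho * (1 - rho)))).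
Proof.
move=> r01 m.
rewrite (@countE_sum_sqr _ _ _ m (fun l : nat => 2 * l%:R * (l%:R - 1) * (rho * (1 - rho)) ^+ 2
     + 4 * (rho * l%:R - mu) ^+ 2 * (l%:R * (rho * (1 - rho)))))//.
- by rewrite subrr expr0n addr0.
- move=> l; have HE := traceE_expectation (nseq l true) r01.
  have [h _] := binomial_moments l 1 (2 * (rho * l%:R - mu)) (m l) r01.
  rewrite -[RHS]h; apply: (exp_ext HE) => w; rewrite /count_stat /m /centred2 /centred; ring.
- move=> l; have HE := traceE_expectation (nseq l true) r01.
  have [_ h] := binomial_moments l 1 (2 * (rho * l%:R - mu)) 0 r01.
  transitivity (1 ^+ 2 * (2 * l%:R * (l%:R - 1) * (rho * (1 - rho)) ^+ 2)
    + (2 * (rho * l%:R - mu)) ^+ 2 * (l%:R * (rho * (1 - rho))) + 0 ^+ 2); last by ring.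
  rewrite -h; apply: (exp_ext HE) => w.
  by congr (_ ^+ 2); rewrite /count_stat /m /centred2 /centred; ring.
Qed.

Lemma pair_var_le (R : realType) (rho : R) (l : nat) : 0 <= rho <= 1 ->
  2 * l%:R * (l%:R - 1) * (rho * (1 - rho)) ^+ 2 <= 2 * (rho * l%:R) ^+ 2.
Proof.
move=> /andP[r0 r1].
have s1 : rho * (1 - rho) <= rho by rewrite ler_piMr//; lra.
have s0 : 0 <= rho * (1 - rho) by rewrite mulr_ge0//; lra.
apply: (@le_trans _ _ (2 * l%:R * l%:R * (rho * (1 - rho)) ^+ 2)).
  apply: ler_wpM2r; first exact: sqr_ge0.
  by rewrite ler_wpM2l ?mulr_ge0//; lra.
have -> : 2 * (rho * l%:R) ^+ 2 = 2 * l%:R * l%:R * rho ^+ 2 by ring.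
by rewrite ler_wpM2l ?mulr_ge0// lerXn2r ?nnegrE.
Qed.

(** Bounds the variance on a far string by the square of its mean shift [E]. The factor 12 is what
    Chebyshev at distance [E / 2] needs for error [1 / 3]. *)
Lemma deviation_moments (R : realType) (rho mu E0 : R) (n L : nat) (ls : seq nat) :
  0 <= rho <= 1 -> mu = rho * L%:R -> size ls = n -> sumn ls = (n * L)%N ->
  let d (l : nat) := rho * l%:R - mu in
  let E := \sum_(l <- ls) d l ^+ 2 in
  0 < E0 -> E0 <= E -> 400 * (n%:R * mu ^+ 2) <= E0 ^+ 2 -> 200 * mu <= E0 -> 200 ^+ 2 <= E0 ->
  12 * \sum_(l <- ls) (2 * l%:R * (l%:R - 1) * (rho * (1 - rho)) ^+ 2
     + 4 * d l ^+ 2 * (l%:R * (rho * (1 - rho)))) <= E ^+ 2.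
Proof.
move=> r01; have [r0 r1] := andP r01; move=> muE sls sumls d E E00 EE h1 h2 h3.
have mu0 : 0 <= mu by rewrite muE mulr_ge0.
have dE l : l \in ls -> d l ^+ 2 <= E.
  move=> lls; rewrite /E (big_rem _ lls) /= lerDl; apply: sumr_ge0 => i _; exact: sqr_ge0.
have d0 : \sum_(l <- ls) d l = 0.
  rewrite sumrB -mulr_sumr -natr_sum -sumnE sumls big_const_seq count_predT iter_addr_0 sls.
  by rewrite muE natrM mulrCA mulr_natl subrr.
have bound : \sum_(l <- ls) (2 * l%:R * (l%:R - 1) * (rho * (1 - rho)) ^+ 2
     + 4 * d l ^+ 2 * (l%:R * (rho * (1 - rho)))) <=
   \sum_(l <- ls) (2 * mu ^+ 2 + 4 * mu * d l + (2 + 4 * mu + E / 100 + 400) * d l ^+ 2).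
  rewrite big_seq [leRHS]big_seq; apply: ler_sum => l lls; have := dE l lls.
  set D := d l; have lE : rho * l%:R = mu + D by rewrite /D /d; ring.
  move=> DE.
  have p0 : 0 <= rho * l%:R by rewrite mulr_ge0.
  have s1 : rho * (1 - rho) <= rho by rewrite ler_piMr//; lra.
  have s0 : 0 <= rho * (1 - rho) by rewrite mulr_ge0//; lra.
  have b1 := pair_var_le l r01.
  have b2 : 4 * D ^+ 2 * (l%:R * (rho * (1 - rho))) <= 4 * D ^+ 2 * (rho * l%:R).
    apply: ler_wpM2l; first by rewrite mulr_ge0 ?sqr_ge0.
    by rewrite [leRHS]mulrC; apply: ler_wpM2l.
  (* Reduces the cubic term [4 * D ^ 3] to a multiple of [D ^ 2]; the linear term in [D] sums to
     zero. *)
  have b3 : 2 * D <= E / 200 + 200.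
    have := sqr_ge0 (D - 200); lra.
  have b4 := ler_wpM2r (sqr_ge0 D) b3.
  rewrite lE in b1 b2; lra.
apply: le_trans (_ : 12 * (2 * (n%:R * mu ^+ 2) + (2 + 4 * mu + E / 100 + 400) * E) <= _).
  rewrite ler_pM2l//; apply: le_trans bound _.
  have -> : 2 * (n%:R * mu ^+ 2) = \sum_(l <- ls) (2 * mu ^+ 2).
    by rewrite big_const_seq count_predT iter_addr_0 sls -mulr_natl; ring.
  rewrite !big_split /= -[\sum_(i <- ls) 4 * mu * _]mulr_sumr d0 mulr0 addr0.
  by rewrite -[\sum_(i <- ls) (_ + 400) * _]mulr_sumr.
have e1 : E0 ^+ 2 <= E ^+ 2 by rewrite lerXn2r ?nnegrE; lra.
have E_0 : 0 <= E by lra.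
have e2 : 200 * mu * E <= E * E by rewrite ler_wpM2r//; lra.
have e3 : 200 ^+ 2 * E <= E * E by rewrite ler_wpM2r//; lra.
lra.
Qed.

Lemma dense_tester (R : realType) (N n L : nat) (rho eps mu E0 : R) :
  N = (n * L)%N -> (0 < n)%N -> 0 <= rho <= 1 -> 0 < eps -> mu = rho * L%:R ->
  E0 = eps ^+ 2 * (n%:R * mu ^+ 2) ->
  n%:R * (1 - rho) ^+ L <= 1 / 6 ->
  400 * (n%:R * mu ^+ 2) <= E0 ^+ 2 -> 200 * mu <= E0 -> 200 ^+ 2 <= E0 ->
  exists A : pred (seq bool),
    (forall a, traceE rho (alternating a (nseq n L)) (fun w => (~~ A w)%:R) <= 1 / 3)
  /\ forall a ls, size ls = n -> sumn ls = N ->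
        eps * N%:R <= \sum_(l <- ls) `|l%:R - L%:R| ->
        traceE rho (alternating a ls) (fun w => (A w)%:R) <= 1 / 3.
Proof.
move=> NE n0 r01 e0 muE E0E hz h1 h2 h3; have [r0 r1] := andP r01.
have n0' : 0 < n%:R :> R by rewrite ltr0n.
have E00 : 0 < E0 by lra.
pose Z ks := \sum_(k <- ks) count_stat rho mu k.
pose thr := rho ^+ 2 * N%:R + E0 / 2.
(* The means are [rho ^ 2 * N] for uniform strings and at least [E0] more for far ones, by
   Cauchy-Schwarz. A uniform string errs with probability at most [1 / 6] through a lost block and
   [1 / 6] through a large [Z]. *)
pose A w := let ks := map size (blocks w) in (size ks == n) && (Z ks <= thr).
exists A; split=> [a|a ls sls sumls dls]; rewrite traceE_alternating//.
- have HC := countE_expectation (nseq n L) r01.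
  have c0 : countE rho (nseq n L) (fun ks => (~~ A (alternating a ks))%:R) <=
     countE rho (nseq n L) (fun ks => (~~ all (leq 1) ks)%:R)
     + countE rho (nseq n L) (fun ks => (thr < Z ks)%R%:R).
    rewrite -(expD HC); apply: countE_le => // ks; rewrite size_nseq => sks.
    case: (boolP (all _ ks)) => [/(map_size_blocks a) e|_]; last first.
      by case: (A _); case: (thr < _)%R => /=; lra.
    by rewrite /A e sks eqxx add0r ltNge.
  have c1 : countE rho (nseq n L) (fun ks => (~~ all (leq 1) ks)%:R) <= 1 / 6.
    apply: le_trans (count_zero_le _ r01) _.
    by rewrite big_nseq iter_addr_0 -[_ *+ n]mulr_natl.
  suff : countE rho (nseq n L) (fun ks => (thr < Z ks)%R%:R) <= 1 / 6.
    by move=> c2; move: c0 c1 c2; lra.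
  have E02 : 0 < E0 / 2 by lra.
  have mE : \sum_(l <- nseq n L) ((rho * l%:R - mu) ^+ 2 + rho ^+ 2 * l%:R) = rho ^+ 2 * N%:R.
    by rewrite big_nseq iter_addr_0 muE subrr expr0n add0r NE natrM -mulr_natr; ring.
  apply: le_trans (chebyshev HC (f := Z) (m := rho ^+ 2 * N%:R) E02 _) _.
    by move=> ks h; rewrite lerXn2r ?nnegrE; move: h; rewrite /thr; lra.
  have := countE_count_stat mu (nseq n L) r01; rewrite /= mE => ->.
  rewrite big_nseq iter_addr_0 -muE subrr expr0n /= mulr0 mul0r addr0 -[_ *+ n]mulr_natl.
  rewrite ler_pdivrMr ?exprn_gt0//.
  have := pair_var_le L r01; rewrite -muE.
  move=> h; have := ler_wpM2l (ltW n0') h; have := sqr_ge0 E0; lra.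
- have HC := countE_expectation ls r01.
  pose E := \sum_(l <- ls) (rho * l%:R - mu) ^+ 2.
  have EE0 : E0 <= E.
    have h : eps * (n%:R * mu) <= \sum_(l <- ls) `|rho * l%:R - mu|.
      have -> : \sum_(l <- ls) `|rho * l%:R - mu| = rho * \sum_(l <- ls) `|l%:R - L%:R|.
        by rewrite mulr_sumr; apply: eq_bigr => l _; rewrite muE -mulrBr normrM ger0_norm.
      have -> : eps * (n%:R * mu) = rho * (eps * N%:R) by rewrite NE natrM muE; ring.
      exact: ler_wpM2l.
    have := sum_sqr_ge ls (fun l : nat => `|rho * l%:R - mu|); rewrite sls.
    under [X in _ * X]eq_bigr do rewrite real_normK ?num_real//.
    rewrite -/E => k.
    have mu0 : 0 <= mu by rewrite muE mulr_ge0.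
    have l0 : 0 <= eps * (n%:R * mu) by rewrite !mulr_ge0// ltW.
    have : (eps * (n%:R * mu)) ^+ 2 <= n%:R * E.
      by apply: le_trans k; rewrite lerXn2r ?nnegrE//; apply: le_trans h.
    have -> : (eps * (n%:R * mu)) ^+ 2 = n%:R * E0 by rewrite E0E; ring.
    by rewrite ler_pM2l.
  have E02 : 0 < E / 2 by lra.
  pose m := rho ^+ 2 * N%:R + E.
  have mE : \sum_(l <- ls) ((rho * l%:R - mu) ^+ 2 + rho ^+ 2 * l%:R) = m.
    by rewrite big_split /= -mulr_sumr -natr_sum -sumnE sumls addrC.
  (* A trace with fewer than [n] runs is rejected anyway; with [n] runs, [full_blocks] identifies
     the run lengths with the counts. *)
  apply: (@le_trans _ _ (countE rho ls (fun ks => (Z ks <= thr)%R%:R))).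
    apply: countE_le => // ks sks; rewrite /A.
    case: eqP => [e|_]; last by rewrite ler0n.
    rewrite full_blocks//; move: e; rewrite size_map sks sls //.
  (* As [E0 <= E], the threshold is at least [E / 2] below the mean [m]. *)
  apply: le_trans (chebyshev HC (f := Z) (m := m) E02 _) _.
    move=> ks h; have -> : (Z ks - m) ^+ 2 = (m - Z ks) ^+ 2 by ring.
    by rewrite lerXn2r ?nnegrE; move: h; rewrite /thr /m; lra.
  have := countE_count_stat mu ls r01; rewrite /= mE => ->.
  rewrite ler_pdivrMr ?exprn_gt0//.
  rewrite NE in sumls.
  have := deviation_moments r01 muE sls sumls E00 EE0 h1 h2 h3.
  rewrite -/E; lra.
Qed.

(** * The tester *)

Lemma uniform_strings_alternating (N n : nat) (x : N.-tuple bool) :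
  x \in uniform_strings N n -> exists a, tval x = alternating a (nseq n (N %/ n)%N).
Proof.
by rewrite inE !uniform_block_stringE => /orP[] /eqP ->; [exists true|exists false].
Qed.

Lemma far_block_strings_deviation (R : realType) (N n : nat) (eps : R) (x : N.-tuple bool) :
  (n %| N)%N -> 0 < eps -> x \in far_block_strings N n eps ->
  exists a ls, [/\ size ls = n, sumn ls = N, tval x = alternating a ls
    & eps * N%:R < \sum_(l <- ls) `|l%:R - (N %/ n)%N%:R|].
Proof.
move=> nN e0; rewrite inE => /andP[/block_string_alternating[a [ls [sls xE]]] /forallP far].
have sumls : sumn ls = N by rewrite -(size_alternating a) -xE size_tuple.
exists a, ls; split=> //.
(* The comparison is with the uniform string that starts with the same symbol. *)
have sy : size (uniform_block_string N n a) == N.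
  by rewrite uniform_block_stringE size_alternating sumn_nseq divnK.
have := far (Tuple sy); rewrite inE /=.
have -> /= : (uniform_block_string N n a == uniform_block_string N n true)
  || (uniform_block_string N n a == uniform_block_string N n false).
  by case: (a); rewrite eqxx ?orbT.
rewrite /rel_edit (eqP sy) size_tuple => h.
(* For [N = 0] the inverse of 0 is 0, so the relative distance is 0 and cannot exceed [eps]. *)
have [N0|N0] := posnP N.
  have E : (N + N)%:R = 0 :> R by rewrite N0.
  by move: h; rewrite E invr0 mulr0 mul0r ltNge (ltW e0).
have N0' : 0 < N%:R :> R by rewrite ltr0n.
have edle : (ed x (uniform_block_string N n a))%:R <=
    \sum_(l <- ls) `|l%:R - (N %/ n)%N%:R| :> R.
  apply: le_trans (_ : (\sum_(l <- ls) (l - N %/ n + (N %/ n - l)))%N%:R <= _).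
    rewrite ler_nat; apply: ed_le.
    by have := edits_alternating a (N %/ n) ls; rewrite sls uniform_block_stringE xE.
  rewrite natr_sum; apply: ler_sum => l _.
  have [lL|Ll] := leqP l (N %/ n)%N.
    have /eqP -> : (l - N %/ n == 0)%N by rewrite subn_eq0.
    by rewrite add0n natrB// distrC ler_norm.
  have /eqP -> : (N %/ n - l == 0)%N by rewrite subn_eq0 ltnW.
  by rewrite addn0 natrB ?ler_norm// ltnW.
apply: lt_le_trans edle.
have hE (c d : R) : 0 < c -> 2 / (c + c) * d * c = d by move=> c0; field; lra.
by rewrite -[X in _ < X](hE N%:R _ N0') -natrD ltr_pM2r.
Qed.

Lemma deviation_le (R : realType) (N n : nat) (ls : seq nat) : (n %| N)%N ->
  size ls = n -> sumn ls = N ->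
  \sum_(l <- ls) `|l%:R - (N %/ n)%N%:R| <= 2 * N%:R :> R.
Proof.
move=> nN sls sumls.
apply: le_trans (_ : \sum_(l <- ls) (l%:R + (N %/ n)%N%:R) <= _ :> R).
  apply: ler_sum => l _; apply: le_trans (ler_normB _ _) _.
  by rewrite !normr_nat.
rewrite big_split /= -natr_sum -sumnE sumls big_const_seq count_predT iter_addr_0 sls.
rewrite -[_ *+ n]mulr_natr -natrM divnK//; lra.
Qed.

Lemma traceE1 (R : realType) (x : seq bool) f : traceE (1 : R) x f = f x.
Proof.
elim: x f => //= a x IH f.
by rewrite !IH subrr mul0r mul1r addr0.
Qed.

(** Covers the case where the allowed trace size reaches [N]: nothing is deleted. *)
Lemma exact_tester (R : realType) (N n : nat) (eps : R) : 0 < eps ->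
  exists accept : 1.-tuple (seq bool) -> bool,
    trace_tester (uniform_strings N n) (far_block_strings N n eps) (1 : R) (2%:R / 3%:R) accept.
Proof.
move=> e0.
pose A (w : seq bool) := (w == uniform_block_string N n true)
  || (w == uniform_block_string N n false).
exists (fun w => A (tnth w ord0)); apply: trace_tester1 => [|x|x]; first by rewrite ler01 lexx.
  by rewrite inE traceE1 /A => ->; rewrite divr_ge0.
rewrite inE traceE1 => /andP[_ /forallP far].
suff -> : A x = false by rewrite divr_ge0.
apply/negP => xA; have xU : x \in uniform_strings N n by rewrite inE.
have := implyP (far x) xU; rewrite /rel_edit.
have : (ed x x <= 0)%N by apply: ed_le; exact: edits0.
by rewrite leqn0 => /eqP ->; rewrite mulr0 ltNge (ltW e0).
Qed.

(** No string is far here, as the total deviation is at most [2 * N]; always accepting works with an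
    empty trace. *)
Lemma trivial_tester (R : realType) (N n : nat) (eps : R) :
  (n %| N)%N -> 0 < eps -> (N == 0)%N || (2 < eps) ->
  exists accept : 1.-tuple (seq bool) -> bool,
    trace_tester (uniform_strings N n) (far_block_strings N n eps) (0 : R) (2%:R / 3%:R) accept.
Proof.
move=> nN e0 h; exists (fun=> true).
apply: (@trace_tester1 _ _ _ _ _ predT) => [|x _|x]; first by rewrite lexx ler01.
  rewrite (exp_cst (traceE_expectation _ _)) ?lexx ?ler01//; lra.
move=> /(far_block_strings_deviation nN e0)[a [ls [sls sumls _ dev]]].
exfalso; have := lt_le_trans dev (deviation_le R nN sls sumls).
have [N0|N0] := posnP N; first by rewrite [in _%:R]N0 !mulr0 ltxx.
rewrite ltr_pM2r ?ltr0n// => e2; move: h; rewrite (gtn_eqF N0) /= => /lt_trans /(_ e2).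
by rewrite ltxx.
Qed.

Lemma tester_of_alternating (R : realType) (N n : nat) (rho eps : R) (A : pred (seq bool)) :
  (n %| N)%N -> 0 <= rho <= 1 -> 0 < eps ->
  (forall a, traceE rho (alternating a (nseq n (N %/ n)%N)) (fun w => (~~ A w)%:R) <= 1 / 3) ->
  (forall a ls, size ls = n -> sumn ls = N ->
     eps * N%:R <= \sum_(l <- ls) `|l%:R - (N %/ n)%N%:R| ->
     traceE rho (alternating a ls) (fun w => (A w)%:R) <= 1 / 3) ->
  exists accept : 1.-tuple (seq bool) -> bool,
    trace_tester (uniform_strings N n) (far_block_strings N n eps) rho (2%:R / 3%:R) accept.
Proof.
move=> nN r01 e0 h1 h2; exists (fun w => A (tnth w ord0)); apply: trace_tester1 => // x.
  by move=> /uniform_strings_alternating[a ->].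
move=> /(far_block_strings_deviation nN e0)[a [ls [sls sumls -> dev]]].
exact: h2 (ltW dev).
Qed.

(* Applied with [M = 64 (n / eps) `^ (4 / 5)]. *)
Lemma sparse_case (R : realType) (N n : nat) (eps M : R) :
  (n %| N)%N -> (0 < N)%N -> 0 < eps -> 64 <= M ->
  M ^+ 5 * eps ^+ 4 = 64 ^+ 5 * n%:R ^+ 4 -> 2 * M <= n%:R ->
  exists rho : R, [/\ 0 <= rho <= 1, rho * N%:R <= M
    & exists accept : 1.-tuple (seq bool) -> bool,
      trace_tester (uniform_strings N n) (far_block_strings N n eps) rho (2%:R / 3%:R) accept].
Proof.
move=> nN N0 e0 M64 M5 Mn.
have NE : N = (n * (N %/ n))%N by rewrite mulnC divnK.
have n0 : 0 < n%:R :> R by lra.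
pose s := eps ^+ 2 * M ^+ 3 / (512 * n%:R ^+ 2).
have M0 : 0 < M by lra.
have s0 : 0 <= s by rewrite divr_ge0 ?mulr_ge0 ?exprn_ge0// ltW.
(* The choice of [M] balances signal and noise: [s ^+ 2] is a large constant times [M]. *)
have s2 : s ^+ 2 = 64 ^+ 2 * M.
  have -> : s ^+ 2 = (M ^+ 5 * eps ^+ 4) * M / (512 ^+ 2 * n%:R ^+ 4).
    by rewrite /s; move: n0; move: (n%:R : R) => c c0; field; rewrite gt_eqF.
  rewrite M5; move: n0; move: (n%:R : R) => c c0; field; by rewrite gt_eqF.
have s512 : 512 <= s.
  have : 512 ^+ 2 <= s ^+ 2 by rewrite s2; lra.
  by rewrite ler_pXn2r ?nnegrE.
have [||rho [A [r01 rN h1 h2]]] := sparse_tester NE N0 M0 Mn e0 (erefl s); first lra.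
  by have := ler_wpM2r s0 s512; rewrite -expr2; lra.
by exists rho; split=> //; exact: (tester_of_alternating nN r01 e0 h1 h2).
Qed.

Lemma ln_ge_half (R : realType) (n : nat) : (1 < n)%N -> 1 / 2 <= ln n%:R :> R.
Proof.
move=> n1; have n2 : 2 <= n%:R :> R by rewrite ler_nat.
have i0 : 0 < n%:R^-1 :> R by rewrite invr_gt0; lra.
have i2 : n%:R^-1 <= 2^-1 :> R by rewrite lef_pV2 ?posrE; lra.
have h : -1 < n%:R^-1 - 1 :> R by lra.
have := le_ln1Dx h; rewrite addrC subrK lnV ?posrE; lra.
Qed.

(** With [mu] the expected retained length of a uniform block, the choice of [m] means
    [eps ^ 2 * sqrt n * mu = 2 ^ 20 * ln n], from which all conditions of [dense_tester] follow. *)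
Lemma dense_case (R : realType) (N n : nat) (eps m : R) :
  (n %| N)%N -> (0 < N)%N -> (1 < n)%N -> 0 < eps ->
  m = 2 ^+ 20 * ln n%:R * (Num.sqrt n%:R / eps ^+ 2) ->
  Num.sqrt n%:R * eps ^+ 2 <= 2 ^+ 18 ->
  exists rho : R, [/\ 0 <= rho <= 1, rho * N%:R <= m
    & exists accept : 1.-tuple (seq bool) -> bool,
      trace_tester (uniform_strings N n) (far_block_strings N n eps) rho (2%:R / 3%:R) accept].
Proof.
move=> nN N0 n1 e0 mE P18.
have NE : N = (n * (N %/ n))%N by rewrite mulnC divnK.
have N0' : 0 < N%:R :> R by rewrite ltr0n.
have n0 : (0 < n)%N by apply: leq_trans n1.
have n2 : 2 <= n%:R :> R by rewrite ler_nat.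
have ln2 := ln_ge_half R n1.
have [Nm|mN] := leP N%:R m.
  by exists 1; split; [rewrite ler01 lexx|rewrite mul1r|exact: exact_tester].
set L := (N %/ n)%N in NE.
pose r := Num.sqrt (n%:R : R).
have r1 : 1 <= r by rewrite -[leLHS]sqrtr1 ler_sqrt; lra.
have r2 : r ^+ 2 = n%:R by rewrite sqr_sqrtr; lra.
pose rho := m / N%:R; pose mu := rho * L%:R.
have m0 : 0 <= m by rewrite mE mulr_ge0 ?divr_ge0 ?mulr_ge0 ?sqr_ge0 ?sqrtr_ge0//; lra.
have rN : rho * N%:R = m by rewrite /rho divfK// gt_eqF.
have r01 : 0 <= rho <= 1.
  by rewrite /rho divr_ge0 ?(ltW N0')//= ler_pdivrMr// mul1r ltW.
have [rho0 rho1] := andP r01.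
have nmu : n%:R * mu = m by rewrite -rN NE natrM /mu; ring.
have pmu : eps ^+ 2 * r * mu = 2 ^+ 20 * ln n%:R.
  have : r * (eps ^+ 2 * r * mu) = r * (2 ^+ 20 * ln n%:R).
    have -> : r * (eps ^+ 2 * r * mu) = eps ^+ 2 * (n%:R * mu) by rewrite -r2; ring.
    by rewrite nmu mE -/r; field; rewrite gt_eqF.
  by apply: mulfI; rewrite gt_eqF//; lra.
have mu0 : 0 <= mu by rewrite mulr_ge0.
(* Some uniform block is then lost with probability at most [n * n ^ (- 4) <= 1 / 8]. *)
have lmu : 4 * ln n%:R <= mu.
  have : eps ^+ 2 * r * mu <= 2 ^+ 18 * mu by rewrite ler_wpM2r// [eps ^+ 2 * r]mulrC.
  rewrite pmu; lra.
pose E0 := eps ^+ 2 * (n%:R * mu ^+ 2).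
have K0 : 2 ^+ 19 <= eps ^+ 2 * r * mu by rewrite pmu; lra.
have E0E : E0 = eps ^+ 2 * r * mu * (r * mu) by rewrite /E0 -r2; ring.
have rmu : mu <= r * mu by rewrite ler_peMl.
have E0mu : 2 ^+ 19 * mu <= E0.
  rewrite E0E; apply: le_trans (_ : 2 ^+ 19 * (r * mu) <= _).
    by rewrite ler_wpM2l// exprn_ge0.
  by rewrite ler_wpM2r//; lra.
have [||||A [h1 h2]] := @dense_tester _ N n L rho eps mu E0 NE n0 r01 e0 erefl erefl.
- have e1 : (1 - rho) ^+ L <= expR (- mu).
    have -> : - mu = L%:R * - rho by rewrite /mu; ring.
    rewrite expRM_natl; apply: lerXn2r; rewrite ?nnegrE ?expR_ge0//; first lra.
    by have := expR_ge1Dx (- rho); lra.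
  have e2 : expR (- mu) <= (n%:R ^+ 4)^-1.
    rewrite expRN lef_pV2 ?posrE ?expR_gt0 ?exprn_gt0//; last lra.
    have -> : n%:R ^+ 4 = expR (4 * ln n%:R) :> R by rewrite expRM_natl lnK// posrE; lra.
    by rewrite ler_expR.
  have e3 : n%:R * (n%:R ^+ 4)^-1 = (n%:R ^+ 3)^-1 :> R.
    by move: n2; move: (n%:R : R) => c c2; field; rewrite gt_eqF//; lra.
  have e4 : (n%:R ^+ 3)^-1 <= (2 ^+ 3)^-1 :> R.
    rewrite lef_pV2 ?posrE ?exprn_gt0//; last lra.
    by rewrite lerXn2r ?nnegrE//; lra.
  apply: le_trans (_ : n%:R * (n%:R ^+ 4)^-1 <= _).
    by rewrite ler_wpM2l//; apply: le_trans e2.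
  rewrite e3; lra.
- have -> : E0 ^+ 2 = (eps ^+ 2 * r * mu) ^+ 2 * (n%:R * mu ^+ 2) by rewrite E0E -r2; ring.
  apply: ler_wpM2r; first by rewrite mulr_ge0 ?sqr_ge0.
  apply: le_trans (_ : (2 ^+ 19) ^+ 2 <= _); first by lra.
  by rewrite lerXn2r ?nnegrE ?exprn_ge0//; lra.
- by apply: le_trans E0mu; apply: ler_wpM2r => //; lra.
- by apply: le_trans E0mu; lra.
exists rho; split=> //; first by rewrite rN.
exact: (tester_of_alternating nN r01 e0 h1 h2).
Qed.

Theorem theorem7p19 (R : realType) :
  exists (C : R) (c : nat), 0 < C /\
    forall (N n : nat) (eps : R),
      ~~ odd n -> (n %| N)%N -> 0 < eps ->
      exists rho : R,
        [/\ 0 <= rho <= 1,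
            rho * N%:R <= C * ln n%:R ^+ c *
              ((n%:R / eps) `^ (4%:R / 5%:R) + Num.sqrt n%:R / eps ^+ 2)
          & exists accept : 1.-tuple (seq bool) -> bool,
              trace_tester (uniform_strings N n) (far_block_strings N n eps)
                rho (2%:R / 3%:R) accept].
Proof.
exists (2 ^+ 20), 1%N; split=> [|N n eps en nN e0]; first exact: exprn_gt0.
rewrite expr1.
pose T1 := (n%:R / eps) `^ (4%:R / 5%:R); pose T2 := Num.sqrt n%:R / eps ^+ 2.
rewrite -/T1 -/T2.
have T10 : 0 <= T1 by exact: powR_ge0.
have T20 : 0 <= T2 by rewrite divr_ge0 ?sqrtr_ge0 ?sqr_ge0.
have ln0' : 0 <= ln n%:R :> R.
  by case: (n) => [|k]; [rewrite ln0|rewrite ln_ge0// ler1n].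
have C0 : 0 <= 2 ^+ 20 * ln n%:R :> R by rewrite mulr_ge0// exprn_ge0.
have [triv|] := boolP ((N == 0)%N || (2 < eps)).
  exists 0; split; [by rewrite lexx ler01|by rewrite mul0r mulr_ge0// addr_ge0|].
  exact: trivial_tester.
rewrite negb_or -lt0n -leNgt => /andP[N0 e2].
have n1 : (1 < n)%N.
  rewrite ltn_neqAle; apply/andP; split; first by apply: contraNneq en => <-.
  have [n0|//] := posnP n.
  by move: nN; rewrite {1}n0 dvd0n (gtn_eqF N0).
have n2 : 2 <= n%:R :> R by rewrite ler_nat.
have T11 : 1 <= T1.
  rewrite -[leLHS](powRr0 (n%:R / eps)); apply: ler_powR; last by rewrite divr_ge0.
  by rewrite ler_pdivlMr// mul1r; apply: le_trans n2.
have T15 : T1 ^+ 5 * eps ^+ 4 = n%:R ^+ 4.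
  have -> : T1 ^+ 5 = (n%:R / eps) ^+ 4.
    rewrite -powR_mulrn// /T1 -powRrM divfK ?pnatr_eq0// powR_mulrn//.
    by rewrite divr_ge0// ltW.
  by rewrite expr_div_n divfK// gt_eqF// exprn_gt0.
pose M := 64 * T1.
have M5 : M ^+ 5 * eps ^+ 4 = 64 ^+ 5 * n%:R ^+ 4 by rewrite -T15 /M; ring.
have ln2 := ln_ge_half R n1.
have [Mn|nM] := leP (2 * M) n%:R.
  have [|rho [r01 rN acc]] := sparse_case nN N0 e0 _ M5 Mn; first by rewrite /M; lra.
  exists rho; split=> //; apply: le_trans rN _.
  (* As [ln n >= 1 / 2], the logarithmic factor absorbs the constant 64. *)
  apply: le_trans (_ : 2 ^+ 20 * (1 / 2) * T1 <= _); first by rewrite /M; lra.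
  apply: ler_pM => //; [by rewrite mulr_ge0 ?exprn_ge0//; lra| |by rewrite lerDl].
  by rewrite ler_wpM2l// exprn_ge0.
have [|rho [r01 rN acc]] := dense_case nN N0 n1 e0 erefl; last first.
  exists rho; split=> //; apply: le_trans rN _.
  by rewrite ler_wpM2l// lerDr.
(* Fifth powers clear the exponent [4 / 5]: [n < 2 * M] yields [(sqrt n * eps ^ 2) ^ 2 <= 2 ^ 35],
   which is below [(2 ^ 18) ^ 2]. *)
have : n%:R ^+ 5 * eps ^+ 4 <= (2 * M) ^+ 5 * eps ^+ 4.
  apply: ler_wpM2r; first by rewrite exprn_ge0// ltW.
  have M0 : 0 <= 2 * M by rewrite /M; lra.
  by rewrite lerXn2r ?nnegrE// ltW.
have -> : (2 * M) ^+ 5 * eps ^+ 4 = 2 ^+ 5 * 64 ^+ 5 * n%:R ^+ 4 by rewrite -mulrA -M5; ring.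
have -> : n%:R ^+ 5 * eps ^+ 4 = (Num.sqrt n%:R * eps ^+ 2) ^+ 2 * n%:R ^+ 4.
  by rewrite exprMn sqr_sqrtr; [ring|lra].
rewrite ler_pM2r ?exprn_gt0//; last lra.
move=> h; have P0 : 0 <= Num.sqrt n%:R * eps ^+ 2 by rewrite mulr_ge0 ?sqrtr_ge0 ?sqr_ge0.
rewrite -(@ler_pXn2r _ 2) ?nnegrE ?exprn_ge0//.
by apply: le_trans h _; lra.
Qed.
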